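(* There exists a family of quantum (3D color) codes with parameters $$\Big[\!\Big[\tfrac{2}{3}k(k+1)(2k+1)-(2k+1),\;1,\;2k-1\Big]\!\Big]$$ that realizes the logical $T$ gate transversally for each integer $k\ge 1$. Moreover, all $X$-stabilizers of these codes have weights divisible by $8$ (triply even).
   Context: CSS codes: for binary linear codes $C_2\subseteq C_1\subseteq\mathbb{F}_2^n$ with $\dim C_1-\dim C_2=k'$, the CSS code of $C_2\subseteq C_1$ is the $n$-qubit stabilizer code whose $X$-stabilizers are the $X^{c}$, $c\in C_2$, and whose $Z$-stabilizers are the $Z^{c}$, $c\in C_1^\perp$ (Euclidean dual). Its parameters are $[\![n,k',d]\!]$ with $d=\min\{d_x,d_z\}$, where $d_x$ is the minimum Hamming weight of $C_1\setminus C_2$ and $d_z$ that of $C_2^\perp\setminus C_1^\perp$. Elements of $C_2$ are identified with the $X$-stabilizers. When $k'=1$ and $u\in C_1\setminus C_2$, the logical basis states are, up to normalization, $|0\rangle_L=\sum_{c\in C_2}|c\rangle$, $|1\rangle_L=\sum_{c\in C_2}|c+u\rangle$. Color codes: a $D$-dimensional (here $D=3$) quantum color code is a CSS code defined on a $(D+1)$-colorable $D$-dimensional lattice, with qubits on the vertices and $X$- and $Z$-stabilizers associated with cells. In more detail, the lattice is a finite $D$-dimensional cell complex in which every vertex is incident to exactly $D+1$ edges and whose $D$-cells admit a $(D+1)$-coloring such that any two $D$-cells sharing a $(D-1)$-dimensional face get different colors; an $X$-type stabilizer is associated with each $x$-cell and a $Z$-type stabilizer with each $z$-cell, acting as Pauli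 $X$ or $Z$ on the qubits of the cell, where $2\le x+z\le D+2$. To encode one logical qubit, the lattice is punctured by removing a vertex together with all incident cells of dimension $1,\ldots,D$. $T=\mathrm{diag}(1,e^{i\pi/4})$. The logical $T$ is realized transversally if some tensor product of single-qubit gates on the data qubits preserves the code space and acts, up to global phase, as $|0\rangle_L\mapsto|0\rangle_L$, $|1\rangle_L\mapsto e^{i\pi/4}|1\rangle_L$. *)

(* Defs.v *)
From HB Require Import structures.
From mathcomp Require Import all_boot all_order all_algebra.
From mathcomp Require Import spectral complex.
From mathcomp Require Import reals trigo.

Set Implicit Arguments.
Unset Strict Implicit.
Unset Printing Implicit Defensive.

Import Order.TTheory GRing.Theory Num.Theory.
Local Open Scope ring_scope.

(** * Three-dimensional lattices *)

(** A finite regular cell complex is encoded by its face poset: a finite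
    partial order on the cells, [a < c] meaning that [a] is a proper face of
    [c], together with the dimension function.  Cells are not determined by
    their vertices, so parallel edges and two-sided faces are allowed. *)

Section CellComplexes.
Variables (disp : Order.disp_t) (C : finPOrderType disp) (dim : C -> nat).
Implicit Types (a c : C) (A B V E F : {set C}).

Definition cells (m : nat) : {set C} := [set c | dim c == m].
Definition below c A : {set C} := [set a in A | (a < c)%O].
Definition above c A : {set C} := [set a in A | (c < a)%O].

(** Any two elements of [A] are joined by a chain in which consecutive
    elements of [A] are faces of a common element of [B]. *)
Definition linked A B : Prop :=
  forall a a', a \in A -> a' \in A ->
    connect [rel x y | [&& x \in A, y \in A &
                           [exists b in B, (x < b)%O && (y < b)%O]]] a a'.

(** A graph is a circle iff it is nonempty, connected and 2-regular. *)
Definition circle V E : Prop :=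
  [/\ V != set0,
      forall e, e \in E -> #|below e V| = 2,
      forall v, v \in V -> #|above v E| = 2
    & linked V E].

(** A 2-dimensional complex is a sphere iff it is a connected closed surface
    of Euler characteristic 2. *)
Definition sphere V E F : Prop :=
  [/\ forall e, e \in E -> #|below e V| = 2 /\ #|above e F| = 2,
      forall f, f \in F -> circle (below f V) (below f E),
      forall v, v \in V -> circle (above v E) (above v F),
      linked V E
    & (#|V| + #|F| = #|E| + 2)%N].

(** Every closed cell is a ball: the boundary of an edge is a pair of points,
    that of a 2-cell a circle and that of a 3-cell a sphere. *)
Definition regular_cell_complex : Prop :=
  [/\ forall c, (dim c <= 3)%N,
      forall a c, (a < c)%O -> (dim a < dim c)%N,
      forall e, e \in cells 1 -> #|below e (cells 0)| = 2,
      forall f, f \in cells 2 ->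
        circle (below f (cells 0)) (below f (cells 1))
    & forall q, q \in cells 3 ->
        sphere (below q (cells 0)) (below q (cells 1)) (below q (cells 2))].

(** The complex is a connected closed 3-manifold: the link of a 2-cell is a
    pair of points, that of an edge a circle and that of a vertex a sphere. *)
Definition closed_3manifold : Prop :=
  [/\ cells 0 != set0,
      linked (cells 0) (cells 1),
      forall f, f \in cells 2 -> #|above f (cells 3)| = 2,
      forall e, e \in cells 1 ->
        circle (above e (cells 2)) (above e (cells 3))
    & forall v, v \in cells 0 ->
        sphere (above v (cells 1)) (above v (cells 2)) (above v (cells 3))].

Definition four_valent : Prop :=
  forall v, v \in cells 0 -> #|above v (cells 1)| = 4.

Definition four_colorable : Prop :=
  exists color : C -> 'I_4,
    forall q q' f, q \in cells 3 -> q' \in cells 3 -> f \in cells 2 ->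
      q != q' -> (f < q)%O -> (f < q')%O -> color q != color q'.

Definition color_lattice : Prop :=
  [/\ regular_cell_complex, closed_3manifold, four_valent & four_colorable].

(** Puncturing at [p] removes [p] and all the cells incident to it. *)
Variable p : C.

Definition punctured_cells (m : nat) : {set C} :=
  [set c in cells m | ~~ (p <= c)%O].

Definition num_qubits : nat := #|punctured_cells 0|.

(** The qubits are the remaining vertices, numbered by [enum_val]. *)
Definition qubit_support c : 'rV['F_2]_num_qubits :=
  \row_(i < num_qubits) (enum_val i <= c)%O%:R.

Definition cell_space (m : nat) : {vspace 'rV['F_2]_num_qubits} :=
  <<[seq qubit_support c | c in punctured_cells m]>>%VS.

End CellComplexes.

(** * Binary codes and CSS codes *)

Section Codes.
Variable n : nat.
Implicit Types (u x y c : 'rV['F_2]_n) (C : {vspace 'rV['F_2]_n}).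

Definition hweight x : nat := #|[set i | x 0 i != 0]|.

Definition dotp c x : 'F_2 := \sum_i c 0 i * x 0 i.

Fact dotp_is_linear c : linear (dotp c : 'rV['F_2]_n -> ('F_2)^o).
Proof.
move=> a x y; rewrite /dotp scaler_sumr -big_split /=; apply: eq_bigr => i _.
by rewrite !mxE mulrDr mulrCA.
Qed.
HB.instance Definition _ c :=
  GRing.isLinear.Build 'F_2 'rV['F_2]_n ('F_2)^o *:%R (dotp c : _ -> ('F_2)^o)
    (dotp_is_linear c).

Definition dual C : {vspace 'rV['F_2]_n} :=
  (\bigcap_(c in C) lker (linfun (dotp c : 'rV['F_2]_n -> ('F_2)^o)))%VS.

Lemma mem_dualP C x :
  reflect (forall c, c \in C -> dotp c x = 0) (x \in dual C).
Proof.
rewrite memvE; apply: (iffP subv_bigcapP) => H c Cc; move/(_ c Cc): H.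
  by rewrite -memvE memv_ker lfunE /= => /eqP.
by move=> H; rewrite -memvE memv_ker lfunE /= H.
Qed.

Definition is_min_weight (S : pred 'rV['F_2]_n) (d : nat) : Prop :=
  (exists2 x, S x & hweight x = d) /\ (forall x, S x -> (d <= hweight x)%N).

End Codes.

Record css_code (n : nat) := CSSCode {
  css_C1 : {vspace 'rV['F_2]_n};
  css_C2 : {vspace 'rV['F_2]_n};
  css_sub : (css_C2 <= css_C1)%VS
}.

(** The code on [n] qubits has parameters [[n, k', d]]. *)
Definition css_parameters n (Q : css_code n) (k' d : nat) : Prop :=
  (\dim (css_C1 Q) = \dim (css_C2 Q) + k')%N /\
  exists dx dz : nat,
    [/\ is_min_weight [pred x | (x \in css_C1 Q) && (x \notin css_C2 Q)] dx,
        is_min_weight [pred x | (x \in dual (css_C2 Q))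
                                && (x \notin dual (css_C1 Q))] dz
      & d = minn dx dz].

(** * Quantum states and transversal gates *)

Section Quantum.
Variables (R : realType) (n : nat).
Implicit Types (x y c u : 'rV['F_2]_n).

(** [psi x] is the amplitude of [psi] at the basis state [|x>]. *)
Definition state := {ffun 'rV['F_2]_n -> R[i]^o}.

Definition ket y : state := [ffun x : 'rV['F_2]_n => (x == y)%:R].

Definition pauliX c (psi : state) : state := [ffun x : 'rV['F_2]_n => psi (x - c)].

Definition pauliZ c (psi : state) : state :=
  [ffun x => (-1) ^+ (dotp c x : nat) * psi x].

Definition tensor_gate (U : 'I_n -> 'M[R[i]]_2) (psi : state) : state :=
  [ffun y : 'rV['F_2]_n => \sum_(x : 'rV['F_2]_n) (\prod_i U i (y 0 i) (x 0 i)) * psi x].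

Definition in_code_space (Q : css_code n) (psi : state) : Prop :=
  (forall c, c \in css_C2 Q -> pauliX c psi = psi) /\
  (forall c, c \in dual (css_C1 Q) -> pauliZ c psi = psi).

(** For [k' = 1] the (unnormalized) logical states; the coset of [u], hence
    [logical1 Q u], does not depend on [u] in [C1 \ C2]. *)
Definition logical0 (Q : css_code n) : state :=
  \sum_(c in css_C2 Q) ket c.
Definition logical1 (Q : css_code n) u : state :=
  \sum_(c in css_C2 Q) ket (c + u).

(** The phase [exp (i pi / 4)]. *)
Definition T_phase : R[i] := Complex (cos (pi / 4)) (sin (pi / 4)).

Definition transversal_T (Q : css_code n) : Prop :=
  exists U : 'I_n -> 'M[R[i]]_2,
  exists w : R[i],
    [/\ forall i, U i \is unitarymx,
        `|w| = 1,
        forall psi, in_code_space Q psi -> in_code_space Q (tensor_gate U psi),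
        tensor_gate U (logical0 Q) = w *: logical0 Q
      & forall u, u \in css_C1 Q -> u \notin css_C2 Q ->
          tensor_gate U (logical1 Q u) = (w * T_phase) *: logical1 Q u].

End Quantum.

(** * Three-dimensional color codes *)

(** [cc_code] is the CSS code whose [X]-stabilizers are generated by the
    [cc_x]-cells and whose [Z]-stabilizers are generated by the [cc_z]-cells
    of the lattice punctured at the vertex [cc_puncture]. *)
Record color_code_3d := ColorCode3D {
  cc_disp : Order.disp_t;
  cc_cell : finPOrderType cc_disp;
  cc_dim : cc_cell -> nat;
  cc_puncture : cc_cell;
  cc_x : nat;
  cc_z : nat;
  cc_lattice : color_lattice cc_dim;
  cc_punctureP : cc_dim cc_puncture = 0%N;
  cc_x_le3 : (cc_x <= 3)%N;
  cc_z_le3 : (cc_z <= 3)%N;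
  cc_xz : (2 <= cc_x + cc_z <= 3 + 2)%N;
  cc_code :> css_code (num_qubits cc_dim cc_puncture);
  cc_codeX : css_C2 cc_code = cell_space cc_dim cc_puncture cc_x;
  cc_codeZ : dual (css_C1 cc_code) = cell_space cc_dim cc_puncture cc_z
}.

Definition cc_length (Q : color_code_3d) : nat :=
  num_qubits (@cc_dim Q) (cc_puncture Q).

(* Main.v *)
Require Import Defs.
From HB Require Import structures.
From mathcomp Require Import all_boot all_order all_algebra zify ring.
From mathcomp Require Import spectral complex.
From mathcomp Require Import reals trigo.

Set Implicit Arguments.
Unset Strict Implicit.
Unset Printing Implicit Defensive.

Import Order.TTheory GRing.Theory Num.Theory.

(** A four-valent four-colourable 3-manifold is a graph with four edge colours:
    the [m]-cells are the components of the subgraphs with [m] colours, and the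
    complex is a manifold as soon as the components with three colours have
    Euler characteristic 2.  The lattices are towers: the lattice of dimension
    [D] and distance [2 t + 1] is the prism over the one of dimension [D - 1] and
    the same distance, joined by a connected sum at a vertex to the one of
    dimension [D] and distance [2 t - 1].  The [X]-stabilizers are then the words
    [(c, c + b, g + b)] with [c] and [g] [X]-stabilizers of the two pieces and [b]
    constant.  This doubling of codes turns weights divisible by [2 ^ (D - 1)]
    into weights divisible by [2 ^ D], and an odd word [(x, y, z)] commuting with
    them has either [x + y] odd, hence long, or [z] long and [x], [y] nonzero.
    Finally [T ^ n] on each of the [n] qubits is a logical [T], since [n ^ 2 = 1]
    modulo 8. *)

(** * Residues of edge-coloured graphs *)

(** The lattice must encode exactly one qubit: each word orthogonal to all 2-cells has to be an
    X-stabilizer up to a constant. This is [complete_code]. Like the other properties it is carried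
    through the whole tower, X-stabilizers having all colours but one and Z-stabilizers two. At
    distance 3 the dimensions 1, 2 and 3 give 3, 7 and 15 qubits. The obstacle in a connected sum is
    that paths through a removed vertex have to be rerouted. Parity does it: the neighbours of such
    a vertex stay connected without it. Residues are then described by labels, in which one value
    [None] stands for everything that met a removed vertex. The distance is a statement about [dz]
    alone. C1 is C2 plus the all-ones word, and the words of C1 outside C2 are odd and commute with
    the X-stabilizers, so [dx] is at least [dz]. *)

Section Residues.
Variables (K V : finType) (s : K -> V -> V).
Hypotheses (sK : forall a, involutive (s a)) (sN : forall a x, s a x != x).
Implicit Types (S T : {set K}) (A B : {set V}) (a b : K) (x y z : V).

Definition adj T : rel V := [rel x y | [exists a in T, s a x == y]].
Definition conn T : rel V := connect (adj T).
Definition res T x : {set V} := [set y | conn T x y].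

Lemma conn_refl T x : conn T x x.
Proof. exact: connect0. Qed.

Lemma conn_trans T y x z : conn T x y -> conn T y z -> conn T x z.
Proof. exact: connect_trans. Qed.

Lemma conn_step T a x : a \in T -> conn T x (s a x).
Proof. by move=> aT; apply: connect1; apply/exists_inP; exists a. Qed.

Lemma conn_sym T x y : conn T x y = conn T y x.
Proof.
apply: sym_connect_sym => {}x {}y; apply/exists_inP/exists_inP => -[a aT /eqP <-];
  by exists a; rewrite ?sK.
Qed.

Lemma conn_ind T (P : V -> Prop) x y :
    P x -> (forall z a, a \in T -> P z -> P (s a z)) -> conn T x y -> P y.
Proof.
move=> Px IH /connectP[p]; elim: p x Px => [|z p IHp] x Px /=; first by move=> _ ->.
by case/andP=> /exists_inP[a aT /eqP <-]; apply/IHp/IH.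
Qed.

Lemma conn_sub S T x y : S \subset T -> conn S x y -> conn T x y.
Proof.
move/subsetP=> sST; apply: (conn_ind (P := fun y => conn T x y)); first exact: conn_refl.
by move=> z a aS cz; apply: conn_trans cz (conn_step _ (sST _ aS)).
Qed.

Lemma mem_res T x y : (y \in res T x) = conn T x y. Proof. by rewrite inE. Qed.

Lemma res_self T x : x \in res T x. Proof. by rewrite mem_res conn_refl. Qed.

Lemma res_eqE T x y : (res T x == res T y) = conn T x y.
Proof.
apply/eqP/idP => [|cxy]; first by move/setP/(_ y); rewrite !mem_res conn_refl.
apply/setP=> z; rewrite !mem_res; apply/idP/idP; last exact: conn_trans.
by apply: conn_trans; rewrite conn_sym.
Qed.

Lemma res_eq T x y : conn T x y -> res T x = res T y.
Proof. by rewrite -res_eqE => /eqP. Qed.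

Lemma res_step T a x : a \in T -> res T (s a x) = res T x.
Proof. by move=> aT; apply/esym/res_eq/conn_step. Qed.

Lemma res_sub S T x : S \subset T -> res S x \subset res T x.
Proof. by move=> sST; apply/subsetP=> y; rewrite !mem_res; apply: conn_sub. Qed.

Lemma res0 x : res set0 x = [set x].
Proof.
apply/setP=> y; rewrite mem_res inE; apply/idP/eqP => [|->]; last exact: conn_refl.
by apply: (conn_ind (P := fun y => y = x)) => // z a; rewrite inE.
Qed.

Lemma res1 a x : res [set a] x = [set x; s a x].
Proof.
apply/setP=> y; rewrite mem_res !inE; apply/idP/idP.
  apply: (conn_ind (P := fun y => (y == x) || (y == s a x))) => [|z b /set1P->]; first by rewrite eqxx.
  by case/orP=> /eqP->; rewrite ?sK eqxx ?orbT.
by case/orP=> /eqP->; rewrite ?conn_refl ?conn_step ?inE.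
Qed.

Definition ncomp T A : nat := #|res T @: A|.

Lemma ncomp0 A : ncomp set0 A = #|A|.
Proof. by rewrite /ncomp card_imset // => x y; rewrite !res0 => /set1_inj. Qed.

Lemma ncomp_edge a A : (forall x, x \in A -> s a x \in A) ->
  (ncomp [set a] A * 2)%N = #|A|.
Proof.
move=> clA; rewrite -[RHS]sum1_card (partition_big_imset (res [set a])) /=.
rewrite /ncomp -sum_nat_const; apply: eq_bigr => _ /imsetP[x xA ->].
rewrite -[LHS](_ : #|res [set a] x| = 2); last first.
  by rewrite res1 cards2 eq_sym sN.
rewrite -sum1_card; apply: eq_bigl => y; rewrite res_eqE mem_res conn_sym andbC.
case cxy: (conn _ y x) => //=; apply/esym.
by move: cxy; rewrite conn_sym -mem_res res1 !inE => /orP[]/eqP-> //; apply: clA.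
Qed.

(** A fixed-point-free involution pairs off the elements. This parity is behind [neighbors_linked],
    the commutation of stabilizers and the odd weight of punctured residues. *)
Lemma even_closed a A : (forall x, x \in A -> s a x \in A) -> ~~ odd #|A|.
Proof. by move/ncomp_edge <-; rewrite oddM andbF. Qed.

Lemma res_closed T a x y : a \in T -> y \in res T x -> s a y \in res T x.
Proof. by rewrite !mem_res => aT /conn_trans; apply; apply: conn_step. Qed.

Lemma ncomp_res_edge T a x : a \in T -> (ncomp [set a] (res T x) * 2)%N = #|res T x|.
Proof. by move=> aT; apply: ncomp_edge => y; apply: res_closed. Qed.

Lemma ncomp_le1 S T x : S \subset T -> ncomp T (res S x) = 1%N.
Proof.
move=> sST; rewrite /ncomp (_ : _ @: _ = [set res T x]) ?cards1 //.
apply/setP=> B; rewrite inE; apply/imsetP/eqP => [[y]|->]; last by exists x; rewrite ?res_self.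
by rewrite mem_res => cxy ->; apply/esym/res_eq/conn_sub/cxy.
Qed.

(** Euler's relation V - E + F = 2 for a three-coloured surface, with E eliminated: three edges at
    each vertex give 2E = 3V, hence 2F = V + 4. *)
Definition spherical : Prop := forall T x, #|T| = 3 ->
  (2 * \sum_(S : {set K} | (S \subset T) && (#|S| == 2%N)) ncomp S (res T x))%N
  = (#|res T x| + 4)%N.

Definition connected : Prop := forall x y, conn setT x y.

End Residues.

(** * The cell complex of residues *)

Fact residue_display : Order.disp_t. Proof. exact: Order.Disp tt tt. Qed.

Section ResidueCells.
Variables (K V : finType) (s : K -> V -> V).

(** The full colour set is excluded because its component is the whole manifold, not a cell. *)
Definition is_residue (c : {set K} * {set V}) : bool :=
  (c.1 != setT) && [exists x, c.2 == res s c.1 x].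

(* An [m]-cell is a connected component of the edges of [m] given colours; the
   colours are recorded since distinct cells may have the same vertices. *)
Definition rcell : Type := {c | is_residue c}.

HB.instance Definition _ := Finite.copy rcell {c | is_residue c}.

Implicit Types c d q : rcell.

Definition ctype c : {set K} := (val c).1.
Definition cset c : {set V} := (val c).2.

Definition rcell_le c d : bool := (ctype c \subset ctype d) && (cset c \subset cset d).

Fact rcell_le_refl : reflexive rcell_le.
Proof. by move=> c; rewrite /rcell_le !subxx. Qed.

Fact rcell_le_anti : antisymmetric rcell_le.
Proof.
move=> c d /andP[/andP[a1 a2] /andP[b1 b2]]; apply: val_inj.
have e1 : ctype c = ctype d by apply/eqP; rewrite eqEsubset a1.
have e2 : cset c = cset d by apply/eqP; rewrite eqEsubset a2.
by move: e1 e2; rewrite /ctype /cset; case: (val c) (val d) => ? ? [? ?] /= -> ->.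
Qed.

Fact rcell_le_trans : transitive rcell_le.
Proof.
move=> d c q /andP[a1 a2] /andP[b1 b2]; apply/andP.
by split; [apply: subset_trans a1 b1 | apply: subset_trans a2 b2].
Qed.

HB.instance Definition _ := Order.Le_isPOrder.Build residue_display rcell
  rcell_le_refl rcell_le_anti rcell_le_trans.

Definition cdim c : nat := #|ctype c|.

End ResidueCells.

Section Lattice.
Variables (K V : finType) (s : K -> V -> V).
Hypotheses (sK : forall a, involutive (s a)) (sN : forall a x, s a x != x).
Implicit Types (c d q f e : rcell s) (S T : {set K}) (a b : K) (x y : V).

Lemma rcell_proper c : ctype c != setT.
Proof. by case/andP: (valP c). Qed.

Lemma cset_res c x : x \in cset c -> cset c = res s (ctype c) x.
Proof.
case/andP: (valP c) => _ /existsP[y /eqP]; rewrite /cset /ctype => ->.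
by rewrite mem_res => /(res_eq sK) ->.
Qed.

Lemma rcell_ex c : exists x, x \in cset c.
Proof.
case/andP: (valP c) => _ /existsP[y /eqP cy].
by exists y; rewrite /cset cy res_self.
Qed.

Lemma rcell_inj_at x c d : x \in cset c -> x \in cset d -> ctype c = ctype d -> c = d.
Proof.
move=> /cset_res cx /cset_res dx e; apply: val_inj.
by move: e cx dx; rewrite /ctype /cset; case: (val c) (val d) => ? ? [? ?] /= -> -> ->.
Qed.

(** A cell is determined by its colours and one of its vertices, so at a common vertex the order is
    inclusion of colour sets. *)
Lemma le_at x c d : x \in cset c -> (c <= d)%O = (ctype c \subset ctype d) && (x \in cset d).
Proof.
move=> xc; apply/andP/andP => -[sT h]; split=> //; first exact: (subsetP h).
by rewrite (cset_res xc) (cset_res h) res_sub.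
Qed.

Lemma lt_dim c d : (c < d)%O = (c <= d)%O && (cdim c < cdim d)%N.
Proof.
rewrite lt_neqAle andbC; case cd: (c <= d)%O => //=.
have [x xc] := rcell_ex c; move: (cd); rewrite (le_at _ xc) => /andP[sT xd].
apply/idP/idP => [|h]; last by apply: contraTneq h => ->; rewrite ltnn.
apply: contraR; rewrite -leqNgt => h; apply/eqP/(rcell_inj_at xc xd)/eqP.
by rewrite eqEcard sT.
Qed.

Definition mkcell T (hT : T != setT) x : rcell s.
Proof.
by exists (T, res s T x); rewrite /is_residue hT /=; apply/existsP; exists x.
Defined.

Lemma mem_mkcell T (hT : T != setT) x : x \in cset (mkcell hT x).
Proof. exact: res_self. Qed.

(** Exactly one cell of each proper colour set passes through [x], so counting cells above [c] is
    counting colour sets. *)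
Lemma card_above_at x c (P : pred {set K}) : x \in cset c ->
  #|[set d | (c <= d)%O && P (ctype d)]|
  = #|[set T : {set K} | [&& ctype c \subset T, T != setT & P T]]|.
Proof.
move=> xc; rewrite -(card_in_imset (f := @ctype _ _ s)); last first.
  move=> d d'; rewrite !inE !(le_at _ xc) => /andP[/andP[_ xd] _] /andP[/andP[_ xd'] _].
  exact: rcell_inj_at xd xd'.
apply: eq_card => T; rewrite inE; apply/imsetP/and3P => [[d]|[cT hT PT]].
  by rewrite inE => /andP[/andP[cd _] Pd] ->; rewrite rcell_proper.
exists (mkcell hT x) => //.
by rewrite inE PT andbT (le_at _ xc) cT mem_mkcell.
Qed.

Lemma card_succ_sets S T : S \subset T ->
  #|[set Q : {set K} | [&& S \subset Q, Q \subset T & #|Q| == #|S|.+1]]| = (#|T| - #|S|)%N.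
Proof.
move=> sST; have := cardsD T S; rewrite (setIidPr sST) => <-.
rewrite -[RHS](card_in_imset (f := fun a => a |: S)).
  apply: eq_card => Q; rewrite inE; apply/and3P/imsetP => [[sSQ sQT /eqP cQ]|[a]].
    have /eqP/cards1P[a Ea] : #|Q :\: S| = 1%N.
      by rewrite cardsD (setIidPr sSQ) cQ subSnn.
    have aQ : a \in Q :\: S by rewrite Ea inE.
    exists a; first by move: aQ; rewrite !inE => /andP[-> /(subsetP sQT)].
    by rewrite -[LHS](setID _ S) (setIidPr sSQ) Ea setUC.
  rewrite inE => /andP[aS aT] ->.
  by rewrite subsetUr subUset sub1set aT sST cardsU1 aS eqxx.
move=> a b; rewrite !inE => /andP[aS _] /andP[bS _] /setP/(_ a).
by rewrite !inE eqxx /= (negPf aS) orbF => /esym/eqP.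
Qed.

(* The cells above [c] with colours in [T] form a Boolean lattice; with
   [T = setT] this describes the link of [c]. *)
Definition link c T m : {set rcell s} :=
  [set d | [&& (c <= d)%O, ctype d \subset T & cdim d == m]].

Lemma card_link_succ n c T : cdim c = n -> ctype c \subset T -> (n.+1 < #|K|)%N ->
  #|link c T n.+1| = (#|T| - n)%N.
Proof.
move=> <- sT lt; have [x xc] := rcell_ex c.
rewrite -card_succ_sets //.
rewrite (card_above_at (fun Q => (Q \subset T) && (#|Q| == (cdim c).+1)) xc).
apply: eq_card => Q; rewrite !inE /cdim; congr (_ && _).
case: (#|Q| =P _) => [cQ|]; rewrite ?andbF // !andbT; apply/andb_idl => _.
apply: contraTneq lt => QT; rewrite -leqNgt.
by rewrite -cardsT -QT cQ.
Qed.

(** Two cells one colour above [c] lie under the cell coloured by the union through the same vertex;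
    the bound on [#|K|] keeps that union proper. *)
Lemma linked_link n c T : cdim c = n -> (n.+2 < #|K|)%N ->
  linked (link c T n.+1) (link c T n.+2).
Proof.
move=> <- lt d d' dL d'L; have [-> //|neq] := eqVneq d d'.
move: (dL) (d'L); rewrite !inE => /and3P[cd dT /eqP cQ] /and3P[cd' d'T /eqP cQ'].
have [x xc] := rcell_ex c; move: (cd) (cd'); rewrite !(le_at _ xc).
move=> /andP[sd xd] /andP[sd' xd'].
set Q := ctype d :|: ctype d'.
have cardQ : #|Q| = (cdim c).+2.
  apply/eqP; rewrite eqn_leq; apply/andP; split.
    have: (cdim c <= #|ctype d :&: ctype d'|)%N by rewrite subset_leq_card // subsetI sd.
    have := cardsUI (ctype d) (ctype d'); rewrite -/(cdim d) -/(cdim d') cQ cQ' -/Q.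
    by move=> /eqP; rewrite addSnnS addnC => /eqP E h;
       rewrite -(leq_add2l #|ctype d :&: ctype d'|) E leq_add2r.
  rewrite -cQ proper_card // properE subsetUl /=; apply: contra neq => h.
  have /eqP e : ctype d' == ctype d.
    by rewrite eqEcard (subset_trans (subsetUr _ _) h) -/(cdim d) -/(cdim d') cQ cQ' leqnn.
  by apply/eqP/(rcell_inj_at xd xd').
have hQ : Q != setT.
  by apply: contraTneq lt => QT; rewrite -cardsT -QT cardQ ltnn.
apply: connect1; rewrite /= dL d'L /=; apply/exists_inP; exists (mkcell hQ x).
  rewrite inE (le_at _ xc) mem_mkcell andbT /cdim /= cardQ eqxx andbT.
  by rewrite (subset_trans sd (subsetUl _ _)) subUset dT.
rewrite !lt_dim (le_at _ xd) (le_at _ xd') mem_mkcell !andbT.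
by rewrite subsetUl subsetUr cQ cQ' /cdim /= cardQ leqnn.
Qed.

(** With three colours to add, the intermediate colour sets are three of size one and three of size
    two, incident like a triangle. This covers both the links of edges and the vertex figures of
    3-cells. *)
Lemma circle_link n c T : cdim c = n -> ctype c \subset T -> #|T| = (n + 3)%N ->
  circle (link c T n.+1) (link c T n.+2).
Proof.
move=> <- sT cT; have cK : (cdim c + 3 <= #|K|)%N by rewrite -cT max_card.
have lt2 : ((cdim c).+2 < #|K|)%N by rewrite (leq_trans _ cK) // addn3.
have lt1 : ((cdim c).+1 < #|K|)%N by apply: ltnW.
have [x xc] := rcell_ex c; split.
- by rewrite -card_gt0 card_link_succ // cT addKn.
- move=> e; rewrite inE => /and3P[ce eT /eqP de].
  have /andP[se xe] : (ctype c \subset ctype e) && (x \in cset e) by rewrite -le_at.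
  transitivity #|link c (ctype e) (cdim c).+1|; last first.
    by rewrite (card_link_succ (n := cdim c)) // -/(cdim e) de -addn2 addKn.
  apply: eq_card => d; rewrite !inE lt_dim de.
  case cd: (c <= d)%O => //=; move: cd; rewrite (le_at _ xc) => /andP[sd xd].
  rewrite (le_at _ xd) xe andbT; case: eqP => [->|]; rewrite ?andbF // ltnSn !andbT.
  by apply: andb_idl => /subset_trans; apply.
- move=> v; rewrite inE => /and3P[cv vT /eqP dv].
  transitivity #|link v T (cdim v).+1|; last first.
    by rewrite (card_link_succ (n := cdim v)) ?dv // cT addnS subSS addKn.
  apply: eq_card => d; rewrite !inE lt_dim dv.
  case vd: (v <= d)%O; rewrite ?andbF //= (le_trans cv vd) /=.
  by case: (cdim d =P _) => [->|_]; rewrite ?andbF ?ltnSn ?andbT.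
- exact: linked_link.
Qed.

Notation cells := (cells (@cdim K V s)).

Lemma above_cells c m : (cdim c < m)%N -> above c (cells m) = link c setT m.
Proof.
move=> lt; apply/setP=> d; rewrite !inE lt_dim subsetT /=.
by case: (cdim d =P m) => [->|_]; rewrite ?lt ?andbF ?andbT.
Qed.

Lemma above_below_cells c q m : (c <= q)%O -> (cdim c < m < cdim q)%N ->
  above c (below q (cells m)) = link c (ctype q) m.
Proof.
move=> cq /andP[cm mq]; have [x xc] := rcell_ex c.
have xq : x \in cset q by move: cq; rewrite (le_at _ xc) => /andP[].
apply/setP=> d; rewrite !inE !lt_dim.
case: (cdim d =P m) => [->|_]; rewrite ?andbF //= cm mq !andbT.
rewrite andbC; case cd: (c <= d)%O => //=.
have xd : x \in cset d by move: cd; rewrite (le_at _ xc) => /andP[].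
by rewrite (le_at _ xd) xq andbT.
Qed.

Lemma below_aboveC c q A : below q (above c A) = above c (below q A).
Proof. by apply/setP=> d; rewrite !inE andbAC. Qed.

Lemma below_below f q A : (f < q)%O -> below f (below q A) = below f A.
Proof.
move=> fq; apply/setP=> d; rewrite !inE -andbA; congr (_ && _).
by apply: andb_idl => /lt_trans; apply.
Qed.

Lemma above_above c v A : (v < c)%O -> above c (above v A) = above c A.
Proof.
move=> vc; apply/setP=> d; rewrite !inE -andbA; congr (_ && _).
by apply: andb_idl; apply: lt_trans.
Qed.

Lemma card_below_type S q : S \subset ctype q ->
  #|[set d : rcell s | (d <= q)%O && (ctype d == S)]| = ncomp s S (cset q).
Proof.
move=> sSq; have hS : S != setT.
  by apply: contraNneq (rcell_proper q) => ST; rewrite -subTset -ST.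
rewrite /ncomp -(card_in_imset (f := @cset _ _ s)).
  apply: eq_card => B; apply/imsetP/imsetP => [[d]|[x xq ->]].
    rewrite inE => /andP[/andP[_ dq] /eqP <-] ->; have [x xd] := rcell_ex d.
    by exists x; [apply: (subsetP dq) | apply: cset_res].
  by exists (mkcell hS x) => //; rewrite inE (le_at _ (mem_mkcell _ _)) sSq xq eqxx.
move=> d d'; rewrite !inE => /andP[_ /eqP td] /andP[_ /eqP td'] e.
by have [x xd] := rcell_ex d; apply: (rcell_inj_at xd); rewrite -?e // td td'.
Qed.

Lemma card_below_cells m q : (m < cdim q)%N ->
  #|below q (cells m)|
  = \sum_(S : {set K} | (S \subset ctype q) && (#|S| == m)) ncomp s S (cset q).
Proof.
move=> mq; rewrite -sum1_card.
rewrite (partition_big (@ctype _ _ s) (fun S => (S \subset ctype q) && (#|S| == m))) /=.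
  apply: eq_bigr => S /andP[sSq /eqP cS]; rewrite -(card_below_type sSq) -sum1_card.
  apply: eq_bigl => d; rewrite !inE lt_dim.
  by case: (ctype d =P S) => [dS|_]; rewrite ?andbF // !andbT /cdim dS cS eqxx mq andbT.
by move=> d; rewrite !inE => /andP[/eqP <-] /ltW /andP[-> _]; rewrite eqxx.
Qed.

Lemma card_below_vertices q : (0 < cdim q)%N -> #|below q (cells 0)| = #|cset q|.
Proof.
move=> q0; rewrite card_below_cells // (big_pred1 set0) ?ncomp0 // => S.
by rewrite cards_eq0; apply: andb_idl => /eqP->; apply: sub0set.
Qed.

Lemma card_below_edge e : e \in cells 1 -> #|below e (cells 0)| = 2.
Proof.
rewrite inE => /eqP de; rewrite card_below_vertices ?de //.
have [x xe] := rcell_ex e; rewrite (cset_res xe).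
have /eqP/cards1P[a ->] := de.
by rewrite (res1 sK) cards2 eq_sym sN.
Qed.

(** A path in the graph becomes a chain of vertex cells, each step crossing one edge cell. The set
    [A] is abstract so that the boundary of a cell and the whole complex are both covered. *)
Lemma linked_skeleton (A E : {set rcell s}) T :
    (forall d, d \in A -> cdim d = 0) ->
    (forall d x a d', d \in A -> x \in cset d -> a \in T -> cdim d' = 0 ->
       s a x \in cset d' -> d' \in A /\ exists2 e, e \in E & (d < e)%O && (d' < e)%O) ->
    (forall d d' x y, d \in A -> d' \in A -> x \in cset d -> y \in cset d' -> conn s T x y) ->
    set0 != setT :> {set K} ->
  linked A E.
Proof.
move=> A0 stepA connA h0 d d' dA d'A.
have [x xd] := rcell_ex d; have [y yd'] := rcell_ex d'.
have Cxy := connA _ _ _ _ dA d'A xd yd'.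
have vtx c z : cdim c = 0 -> z \in cset c -> c = mkcell h0 z.
  move=> c0 zc; apply: (rcell_inj_at zc (mem_mkcell _ _)).
  by apply/eqP; rewrite -cards_eq0 -/(cdim c) c0.
rewrite (vtx d' y) ?A0 //.
suff [] : mkcell h0 y \in A /\ connect [rel x y | [&& x \in A, y \in A &
      [exists b in E, (x < b)%O && (y < b)%O]]] d (mkcell h0 y) by [].
apply: (conn_ind (s := s) (P := fun y => mkcell h0 y \in A /\ connect _ d (mkcell h0 y)) _ _ Cxy).
  by rewrite -(vtx d x) ?A0.
move=> z a aT [zA zC].
have dim0 : cdim (mkcell h0 (s a z)) = 0 by rewrite /cdim /= cards0.
have [e [ez eaz lt]] :=
  stepA _ z a (mkcell h0 (s a z)) zA (mem_mkcell _ _) aT dim0 (mem_mkcell _ _).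
split=> //; apply: connect_trans zC _; apply: connect1.
by rewrite /= zA e; apply/exists_inP; exists ez.
Qed.

Hypotheses (cardK : #|K| = 4) (sC : connected s) (sS : spherical s) (x0 : V).

Let set0_proper : set0 != setT :> {set K}.
Proof. by rewrite eq_sym -card_gt0 cardsT cardK. Qed.

Let vertex_edge d d' x a (h : [set a] != setT) : cdim d = 0 -> cdim d' = 0 ->
  x \in cset d -> s a x \in cset d' ->
  (d < mkcell h x)%O && (d' < mkcell h x)%O.
Proof.
move=> d0 d'0 xd xd'; rewrite !lt_dim (le_at _ xd) (le_at _ xd') d0 d'0 /cdim /= cards1.
rewrite /cset /= !(res1 sK) !inE !eqxx orbT !andbT.
have z c : cdim c = 0 -> ctype c = set0 by move=> c0; apply/eqP; rewrite -cards_eq0 -/(cdim c) c0.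
by rewrite (z d) // (z d') // !sub0set.
Qed.

Let set1_proper a : [set a] != setT.
Proof. by apply/eqP=> /(congr1 (fun A : {set K} => #|A|)); rewrite cards1 cardsT cardK. Qed.

Lemma linked_below q : (1 < cdim q)%N -> linked (below q (cells 0)) (below q (cells 1)).
Proof.
move=> q1; have q0 := ltnW q1; apply: (@linked_skeleton _ _ (ctype q)) => //.
- by move=> d; rewrite !inE => /andP[/eqP].
- move=> d x a d'; rewrite !inE => /andP[/eqP d0 dq] xd aq d'0 xd'.
  have xq : x \in cset q by move: dq; rewrite lt_dim (le_at _ xd) => /andP[/andP[]].
  rewrite d'0 lt_dim (le_at _ xd') d'0 q0 andbT.
  have -> : ctype d' = set0 by apply/eqP; rewrite -cards_eq0 -/(cdim d') d'0.
  rewrite sub0set /= (cset_res xq) res_closed ?res_self //; split=> //.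
  exists (mkcell (set1_proper a) x); last exact: vertex_edge.
  by rewrite !inE lt_dim (le_at _ (mem_mkcell _ _)) xq /cdim /= cards1 sub1set aq.
- move=> d d' x y; rewrite !inE => /andP[_ /ltW dq] /andP[_ /ltW d'q] xd yd'.
  have xq : x \in cset q by move: dq; rewrite (le_at _ xd) => /andP[].
  by move: d'q; rewrite (le_at _ yd') (cset_res xq) mem_res => /andP[].
Qed.

Lemma linked_cells : linked (cells 0) (cells 1).
Proof.
apply: (@linked_skeleton _ _ setT) => //.
- by move=> d; rewrite !inE => /eqP.
- move=> d x a d'; rewrite !inE => /eqP d0 xd _ d'0 xd'; rewrite d'0; split=> //.
  exists (mkcell (set1_proper a) x); last exact: vertex_edge.
  by rewrite !inE /cdim /= cards1.
Qed.

Lemma circle_below f : f \in cells 2 -> circle (below f (cells 0)) (below f (cells 1)).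
Proof.
rewrite inE => /eqP df; split.
- rewrite -card_gt0 card_below_vertices ?df //.
  by have [x xf] := rcell_ex f; apply/card_gt0P; exists x.
- by move=> e; rewrite inE => /andP[e1 ef]; rewrite below_below // card_below_edge.
- move=> v; rewrite !inE => /andP[/eqP v0 vf].
  rewrite above_below_cells ?v0 ?df ?(ltW vf) // (card_link_succ v0) ?cardK //.
  + by rewrite -/(cdim f) df.
  + by have /andP[] := ltW vf.
- by apply: linked_below; rewrite df.
Qed.

Lemma sphere_below q : q \in cells 3 ->
  sphere (below q (cells 0)) (below q (cells 1)) (below q (cells 2)).
Proof.
rewrite inE => /eqP dq; split.
- move=> e; rewrite inE => /andP[e1 eq]; split.
    by rewrite below_below // card_below_edge.
  move: e1; rewrite inE => /eqP e1.
  rewrite above_below_cells ?e1 ?dq ?(ltW eq) //.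
  rewrite (card_link_succ e1) ?cardK //; last by have /andP[] := ltW eq.
  by rewrite -/(cdim q) dq.
- by move=> f; rewrite inE => /andP[f2 fq]; rewrite !below_below //; apply: circle_below.
- move=> v; rewrite !inE => /andP[/eqP v0 vq].
  rewrite !above_below_cells ?v0 ?dq ?(ltW vq) //.
  by apply: (circle_link v0); [have /andP[] := ltW vq | rewrite -/(cdim q) dq].
- by apply: linked_below; rewrite dq.
have [x xq] := rcell_ex q.
(* Doubled, the relation is what [sS] provides, since each of the three colours contributes
   [#|cset q|] to twice the number of edges. *)
apply/eqP; rewrite -(eqn_pmul2l (isT : 0 < 2)) mulnDr (card_below_cells (m := 2)) ?dq //.
rewrite (cset_res xq) sS; last exact: dq.
rewrite mulnDr -!(mulnC _ 2) addnA eqn_add2r -(cset_res xq).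
rewrite card_below_vertices ?dq // (card_below_cells (m := 1)) ?dq //.
rewrite (eq_bigl (fun S => S \in [set [set a] | a in ctype q])); last first.
  move=> S; apply/andP/imsetP => [[sS' /cards1P[a Sa]]|[a aq ->]].
    by exists a; rewrite // -sub1set -Sa.
  by rewrite sub1set aq cards1.
rewrite big_imset /=; last by move=> a b _ _ /set1_inj.
rewrite big_distrl /= (eq_bigr (fun=> #|cset q|)); last first.
  by move=> a aq; rewrite (cset_res xq) (ncomp_res_edge sK sN).
by rewrite sum_nat_const -/(cdim q) dq mulSn mulnC addnC.
Qed.

(** Vertex links are boundaries of tetrahedra: their cells are the proper nonempty sets of the four
    colours, and Euler's relation reads 4 + 4 = 6 + 2. *)
Lemma card_vertex_link v m : v \in cells 0 -> (0 < m < 4)%N ->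
  #|above v (cells m)| = 'C(4, m).
Proof.
rewrite inE => /eqP v0 /andP[m0 m4]; rewrite above_cells ?v0 //.
have [x xv] := rcell_ex v; rewrite -cardK -card_draws.
rewrite (card_above_at (fun Q => (Q \subset setT) && (#|Q| == m)) xv).
apply: eq_card => Q; rewrite !inE subsetT /=.
have -> : ctype v = set0 by apply/eqP; rewrite -cards_eq0 -/(cdim v) v0.
rewrite sub0set /=; apply: andb_idl => /eqP cQ.
by apply: contraTneq m4 => QT; rewrite -leqNgt -cQ QT cardsT cardK.
Qed.

Lemma sphere_link v : v \in cells 0 ->
  sphere (above v (cells 1)) (above v (cells 2)) (above v (cells 3)).
Proof.
move=> vV; move: (vV); rewrite inE => /eqP v0; split.
- move=> f; rewrite !inE => /andP[/eqP f2 vf]; split.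
    rewrite below_aboveC above_below_cells ?v0 ?f2 ?(ltW vf) //.
    rewrite (card_link_succ v0) ?cardK //; last by have /andP[] := ltW vf.
    by rewrite -/(cdim f) f2.
  rewrite above_above // above_cells ?f2 //.
  by rewrite (card_link_succ f2) ?cardK ?subsetT // cardsT cardK.
- move=> q; rewrite !inE => /andP[/eqP q3 vq].
  rewrite !below_aboveC !above_below_cells ?v0 ?q3 ?(ltW vq) //.
  by apply: (circle_link v0); [have /andP[] := ltW vq | rewrite -/(cdim q) q3].
- move=> e; rewrite !inE => /andP[/eqP e1 ve].
  rewrite !above_above // !above_cells ?e1 //.
  by apply: (circle_link e1); rewrite ?subsetT // cardsT cardK.
- rewrite !above_cells ?v0 //; by apply: (@linked_link 0); rewrite ?cardK.
- by rewrite !card_vertex_link.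
Qed.

Lemma four_colorable_residues : four_colorable (@cdim K V s).
Proof.
have [a0 _] : exists a0 : K, a0 \in setT.
  by apply/card_gt0P; rewrite cardsT cardK.
(* A 3-cell receives the edge colour that it misses; two 3-cells with a common vertex and the same
   missing colour coincide. *)
pose miss c := odflt a0 [pick a | a \notin ctype c].
exists (fun c => cast_ord cardK (enum_rank (miss c))) => q q' f.
rewrite !inE => /eqP q3 /eqP q'3 _ neq fq fq'; apply: contra neq.
move=> /eqP/cast_ord_inj/enum_rank_inj e.
have missE c : cdim c = 3 -> ctype c = ~: [set miss c].
  move=> c3; apply/eqP; rewrite eqEcard cardsC1 cardK -/(cdim c) c3 andbT.
  rewrite subsetC sub1set inE /miss; case: pickP => //= c0.
  case/negP: (rcell_proper c); rewrite -subTset; apply/subsetP=> a _.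
  by move/negbFE: (c0 a).
have [x xf] := rcell_ex f; move: (ltW fq) (ltW fq'); rewrite !(le_at _ xf).
move=> /andP[_ xq] /andP[_ xq'].
by apply/eqP/(rcell_inj_at xq xq'); rewrite !missE // e.
Qed.

Theorem residues_color_lattice : color_lattice (@cdim K V s).
Proof.
split; last exact: four_colorable_residues.
- split.
  + move=> c; rewrite -ltnS -cardK -cardsT proper_card // properEneq subsetT.
    by rewrite rcell_proper.
  + by move=> a c; rewrite lt_dim => /andP[].
  + exact: card_below_edge.
  + exact: circle_below.
  + exact: sphere_below.
- split.
  + apply/set0Pn; exists (mkcell set0_proper x0).
    by rewrite inE /cdim /= cards0.
  + exact: linked_cells.
  + move=> f; rewrite inE => /eqP f2; rewrite above_cells ?f2 //.
    by rewrite (card_link_succ f2) ?cardK ?subsetT // cardsT cardK.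
  + move=> e; rewrite inE => /eqP e1; rewrite !above_cells ?e1 //.
    by apply: (circle_link e1); rewrite ?subsetT // cardsT cardK.
  + exact: sphere_link.
- by move=> v vV; rewrite card_vertex_link.
Qed.

End Lattice.

(** * Stacking *)

(* A manifold is encoded by the graph of its vertices and edges, the edges being
   coloured so that each vertex is on exactly one edge of each colour: [gs a x]
   is the other end of the edge of colour [a] at [x].  The vertex [None] is the
   one that will be punctured. *)
Record gem (K : finType) := Gem {
  gpt : finType;
  gs : K -> option gpt -> option gpt;
  gsK : forall a, involutive (gs a);
  gsN : forall a x, gs a x != x
}.
Arguments gsK {K} g a x : rename.
Arguments gsN {K} g a x : rename.

Lemma gs_base K (G : gem K) a : {u | gs a None = Some u :> option (gpt G)}.
Proof. by have := gsN G a None; case: (gs a None) => // u _; exists u. Qed.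

(* Otherwise the vertices other than [None] satisfying [P] would be closed under
   [gs b], hence even in number, and also, without [gs a None], under [gs a]. *)
Lemma neighbors_linked K (G : gem K) (P : pred (option (gpt G))) a b :
    (forall c x, c \in [set a; b] -> x != None -> gs c x != None ->
      P x -> P (gs c x)) ->
  P (gs a None) -> P (gs b None).
Proof.
move=> clP Pa; apply: contraLR (isT) => nPb.
pose A := [set x | (x != None) && P x].
have closed c x : c \in [set a; b] -> x \in A -> gs c x != None -> gs c x \in A.
  by move=> cab; rewrite !inE => /andP[x0 Px] cx; rewrite cx clP.
have aA : gs a None \in A by rewrite inE gsN.
have eA : ~~ odd #|A|.
  apply: (even_closed (gsK G) (gsN G) (a := b)) => x xA; apply: closed => //.
    by rewrite !inE eqxx orbT.
  apply: contraNneq nPb => e; move: xA; rewrite inE => /andP[_].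
  by rewrite -[x](gsK G b) e.
have oA : ~~ odd #|A :\ gs a None|.
  apply: (even_closed (gsK G) (gsN G) (a := a)) => x; rewrite !in_setD1 => /andP[xa xA].
  have x0 : x != None by move: xA; rewrite inE => /andP[].
  rewrite (can_eq (gsK G a)) x0 /=; apply: closed => //; first by rewrite !inE eqxx.
  by apply: contraNneq xa => <-; rewrite gsK.
by move: eA oA; rewrite (cardsD1 (gs a None)) aA /= => /negbNE ->.
Qed.

Section Stack.
Variables (K : finType) (H : gem K) (G : gem (option K)).
Notation M := (gpt H).
Notation U := (gpt G).

Definition copy1 (x : option M) : option (M + M + U) := omap (fun m => inl (inl m)) x.
Definition copy2 (x : option M) : option (M + M + U) := omap (fun m => inl (inr m)) x.
Definition rest (x : option U) : option (M + M + U) := omap inr x.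

(* The prism over [H] has two copies of the vertices of [H] joined by edges of
   the new colour [None].  The base points of the second copy and of [G] are
   removed and the edges ending there are joined according to their colours.
   The base point of the stack is that of the first copy. *)
Definition stack_gs (c : option K) (v : option (M + M + U)) : option (M + M + U) :=
  match c, v with
  | None, None => rest (gs None None)
  | None, Some (inl (inl m)) => copy2 (Some m)
  | None, Some (inl (inr m)) => copy1 (Some m)
  | None, Some (inr u) => rest (gs None (Some u))
  | Some a, None => copy1 (gs a None)
  | Some a, Some (inl (inl m)) => copy1 (gs a (Some m))
  | Some a, Some (inl (inr m)) =>
      if gs a (Some m) is Some m' then copy2 (Some m') else rest (gs (Some a) None)
  | Some a, Some (inr u) =>
      if gs (Some a) (Some u) is Some u' then rest (Some u') else copy2 (gs a None)
  end.

Fact stack_gsK a : involutive (stack_gs a).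
Proof.
case: a => [a|] [[[m|m]|u]|] //=.
- case E: (gs a (Some m)) => [m'|] /=; first by rewrite -E gsK.
  by rewrite -E gsK.
- case E: (gs a (Some m)) => [m'|] /=; first by rewrite -E gsK.
  have [u Eu] := gs_base G (Some a); rewrite Eu /= -Eu gsK /=.
  by rewrite -E gsK.
- case E: (gs (Some a) (Some u)) => [u'|] /=; first by rewrite -E gsK.
  have [m Em] := gs_base H a; rewrite Em /= -Em gsK /=.
  by rewrite -E gsK.
- by have [m Em] := gs_base H a; rewrite Em /= -Em gsK.
- by case E: (gs None (Some u)) => [u'|] /=; rewrite -E gsK.
- by have [u Eu] := gs_base G None; rewrite Eu /= -Eu gsK.
Qed.

Fact stack_gsN a x : stack_gs a x != x.
Proof.
case: a x => [a|] [[[m|m]|u]|] //=.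
- by have := gsN H a (Some m); case: (gs a _).
- have := gsN H a (Some m); case: (gs a _) => //= _.
  by case: (gs (Some a) None).
- have := gsN G (Some a) (Some u); case: (gs (Some a) (Some u)) => //= _.
  by case: (gs a None).
- by have := gsN H a None; case: (gs a _).
- by have := gsN G None (Some u); case: (gs _ _).
- by have := gsN G None None; case: (gs _ _).
Qed.

Definition stack : gem (option K) := Gem stack_gsK stack_gsN.

End Stack.

(** * Residues of a stack *)

Notation gres G := (res (@gs _ G)).
Notation gconn G := (conn (@gs _ G)).

(** [None] encodes the residue through the base point. When the base points of two pieces are
    removed, merging their residues amounts to identifying the two values [None]. *)
Definition base_label K (G : gem K) T (x : option (gpt G)) : option {set option (gpt G)} :=
  if gconn G T None x then None else Some (gres G T x).
Arguments base_label {K} G T x.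

Lemma base_labelE K (G : gem K) T x y :
  (base_label G T x == base_label G T y) = gconn G T x y.
Proof.
rewrite /base_label; case cx: (conn _ T None x); case cy: (conn _ T None y).
- by apply/esym; move: cx; rewrite conn_sym; [move/conn_trans; apply | exact: gsK].
- apply/esym/negbTE; apply: contraFN cy; exact: conn_trans cx.
- apply/esym/negbTE; apply: contraFN cx; rewrite (conn_sym (gsK G)) => yx.
  exact: conn_trans cy _.
by rewrite (inj_eq Some_inj) res_eqE //; apply: gsK.
Qed.

Lemma base_label_step K (G : gem K) (T : {set K}) a x : a \in T ->
  base_label G T (gs a x) = base_label G T x.
Proof.
move=> aT; apply/eqP; rewrite base_labelE.
by rewrite (conn_sym (gsK G)); apply: conn_step.
Qed.

Lemma base_label0 K (G : gem K) T : base_label G T None = None.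
Proof. by rewrite /base_label conn_refl. Qed.

Lemma base_label_eq0 K (G : gem K) T x :
  (base_label G T x == None) = gconn G T None x.
Proof. by rewrite -(base_label0 G T) base_labelE conn_sym //; apply: gsK. Qed.

Lemma conn_neq K (G : gem K) (T : {set K}) x y : gconn G T x y -> x != y -> exists a, a \in T.
Proof.
case: (set_0Vmem T) => [->|[a aT]] xy neq; last by exists a.
by move: xy neq; rewrite -mem_res res0 inE => /eqP->; rewrite eqxx.
Qed.

Section StackResidues.
Variables (K : finType) (H : gem K) (G : gem (option K)).
Notation M := (gpt H).
Notation U := (gpt G).
Implicit Types (T : {set option K}) (a b : K) (c : option K) (m : M) (u : U).
Notation copy1 := (@copy1 K H G).
Notation copy2 := (@copy2 K H G).
Notation rest := (@rest K H G).
Notation G' := (stack H G).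

Definition horizontal T : {set K} := [set a | Some a \in T].

(* The residues through one of the removed base points are merged into a single
   one, labelled [None]; for [None \in T] it contains the base point of the
   stack. The other residues stay in one part of the stack, or are prisms. *)
Definition stack_label T (v : option (M + M + U)) :
    option ({set option M} + {set option M} + {set option U}) :=
  let T0 := horizontal T in
  let l1 (x : option M) :=
    if None \in T then omap (fun A => inl (inl A)) (base_label H T0 x)
    else Some (inl (inl (gres H T0 x))) in
  match v with
  | None => l1 None
  | Some (inl (inl m)) => l1 (Some m)
  | Some (inl (inr m)) =>
      if None \in T then l1 (Some m)
      else omap (fun A => inl (inr A)) (base_label H T0 (Some m))
  | Some (inr u) => omap inr (base_label G T (Some u))
  end.

Lemma stack_label_step T c v : c \in T -> stack_label T (gs (g := G') c v) = stack_label T v.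
Proof.
move=> cT; rewrite /stack_label; case DT: (None \in T); last first.
  case: c cT => [a|]; last by rewrite DT.
  move=> aT; have aT0 : a \in horizontal T by rewrite inE.
  have rs x : gres H (horizontal T) (gs a x) = gres H (horizontal T) x.
    by rewrite res_step //; apply: gsK.
  case: v => [[[m|m]|u]|] /=.
  - by rewrite -(rs (Some m)); case: (gs a (Some m)).
  - rewrite -(base_label_step _ aT0); case: (gs a (Some m)) => //=.
    rewrite !base_label0; have [u Eu] := gs_base G (Some a).
    by rewrite Eu /= -Eu base_label_step // base_label0.
  - rewrite -(base_label_step _ aT); case: (gs (Some a) (Some u)) => //=.
    rewrite !base_label0; have [m Em] := gs_base H a.
    by rewrite Em /= -Em base_label_step // base_label0.
  - by rewrite -(rs None); case: (gs a None).
case: c cT => [a|] aT.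
  have aT0 : a \in horizontal T by rewrite inE.
  case: v => [[[m|m]|u]|] /=.
  - by rewrite -(base_label_step (Some m) aT0); case: (gs a (Some m)).
  - rewrite -(base_label_step (Some m) aT0); case: (gs a (Some m)) => //=.
    rewrite !base_label0; have [u Eu] := gs_base G (Some a).
    by rewrite Eu /= -Eu base_label_step // !base_label0.
  - rewrite -(base_label_step _ aT); case: (gs (Some a) (Some u)) => //=.
    rewrite !base_label0; have [m Em] := gs_base H a.
    by rewrite Em /= -Em base_label_step // !base_label0.
  - by rewrite -(base_label_step None aT0); case: (gs a None).
case: v => [[[m|m]|u]|] //=.
- by rewrite -(base_label_step _ aT); case: (gs None (Some u)); rewrite ?base_label0.
- have [u Eu] := gs_base G None.
  by rewrite Eu /= -Eu base_label_step // !base_label0.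
Qed.

Lemma conn_copy1 T x y : gconn H (horizontal T) x y -> gconn G' T (copy1 x) (copy1 y).
Proof.
apply: (conn_ind (P := fun y => gconn G' T (copy1 x) (copy1 y))); first exact: conn_refl.
move=> z a; rewrite inE => aT /conn_trans; apply.
have -> : copy1 (gs a z) = gs (g := G') (Some a) (copy1 z) by case: z.
exact: conn_step.
Qed.

Lemma connV T x y : gconn G' T x y = gconn G' T y x.
Proof. exact/conn_sym/gsK. Qed.

Lemma step_copy2 T a m m' : Some a \in T -> gs a (Some m) = Some m' ->
  gconn G' T (copy2 (Some m)) (copy2 (Some m')).
Proof.
move=> aT E; have -> : copy2 (Some m') = gs (g := G') (Some a) (copy2 (Some m)) by rewrite /= E.
exact: conn_step.
Qed.

Lemma step_rest T (c : option K) u u' : c \in T -> gs c (Some u) = Some u' ->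
  gconn G' T (rest (Some u)) (rest (Some u')).
Proof.
move=> aT E; have -> : rest (Some u') = gs (g := G') c (rest (Some u)).
  by case: c aT E => [a|] aT E /=; rewrite E.
exact: conn_step.
Qed.

Lemma step_glue T a : Some a \in T ->
  gconn G' T (copy2 (gs a None)) (rest (gs (Some a) None)).
Proof.
move=> aT; have [m Em] := gs_base H a; rewrite Em.
suff <- : gs (g := G') (Some a) (copy2 (Some m)) = rest (gs (Some a) None) by apply: conn_step.
by rewrite /= -Em gsK.
Qed.

(** The edges that ended at the removed base point of the second copy now lead to [rest], but their
    ends in the copy stay connected: [neighbors_linked] is applied to reachability from the first of
    them. *)
Lemma hub_linked T a b : Some a \in T -> Some b \in T ->
  gconn G' T (copy2 (gs a None)) (copy2 (gs b None)).
Proof.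
move=> aT bT; apply: (@neighbors_linked _ H (fun x => gconn G' T (copy2 (gs a None)) (copy2 x)) a b).
  move=> c [m|] // cab _; case E: (gs c (Some m)) => [m'|] // _ /conn_trans; apply.
  by apply: step_copy2 E; move: cab; rewrite !inE => /orP[]/eqP->.
exact: conn_refl.
Qed.

(** A path of [H] through the base point is rerouted by letting [gs a0 None] stand for the missing
    vertex. *)
Lemma conn_copy2 T a0 x y : Some a0 \in T -> gconn H (horizontal T) x y ->
  gconn G' T (copy2 (if x is Some m then x else gs a0 None))
             (copy2 (if y is Some m then y else gs a0 None)).
Proof.
move=> a0T; set j := fun x => copy2 (if x is Some m then x else gs a0 None).
apply: (conn_ind (P := fun y => gconn G' T (j x) (j y))); first exact: conn_refl.
move=> z a; rewrite inE => aT /conn_trans; apply; case: z => [m|].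
  case E: (gs a (Some m)) => [m'|]; first exact: step_copy2 E.
  by rewrite /j -[Some m](gsK H a) E; apply: hub_linked.
by rewrite connV /j; have [m Em] := gs_base H a; rewrite Em -Em; apply: hub_linked.
Qed.

(** Without the vertical colour [None], a path of [G] through its removed base point makes a detour
    through the second copy. *)
Lemma conn_rest T a0 x y : None \notin T -> Some a0 \in T -> gconn G T x y ->
  gconn G' T (if x is Some u then rest x else copy2 (gs a0 None))
             (if y is Some u then rest y else copy2 (gs a0 None)).
Proof.
move=> DT a0T; set j := fun x => if x is Some u then rest x else copy2 (gs a0 None).
apply: (conn_ind (P := fun y => gconn G' T (j x) (j y))); first exact: conn_refl.
move=> z [a|] aT; last by rewrite aT in DT.
move=> /conn_trans; apply; case: z => [u|].
  case E: (gs (Some a) (Some u)) => [u'|]; first exact: step_rest E.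
  rewrite /j connV -[Some u](gsK G (Some a)) E.
  by apply: conn_trans (step_glue aT); apply: hub_linked.
rewrite /j; have [u Eu] := gs_base G (Some a); rewrite Eu -Eu.
by apply: conn_trans (step_glue aT); apply: hub_linked.
Qed.

(** With the vertical colour, the base point of the stack replaces that of [G]: an edge of colour
    [Some a] there is followed through the first copy, a vertical edge and the glued edge. *)
Lemma conn_restV T x y : None \in T -> gconn G T x y -> gconn G' T (rest x) (rest y).
Proof.
move=> DT; apply: (conn_ind (P := fun y => gconn G' T (rest x) (rest y))); first exact: conn_refl.
have base a : Some a \in T -> gconn G' T None (rest (gs (Some a) None)).
  move=> aT; apply: conn_trans (step_glue aT); have [m Em] := gs_base H a.
  rewrite Em; apply: (@conn_trans _ _ _ _ (copy1 (Some m))).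
    by rewrite -Em; apply: (conn_step (@gs _ G') None aT).
  exact: (conn_step (@gs _ G') (copy1 (Some m)) DT).
move=> z c cT /conn_trans; apply; case: z => [u|].
  case E: (gs c (Some u)) => [u'|]; first exact: step_rest E.
  case: c cT E => [a|] cT E.
    by rewrite connV -[Some u](gsK G (Some a)) E; apply: base.
  rewrite (_ : rest None = gs (g := G') None (rest (Some u))); first exact: conn_step.
  by rewrite /= E.
by case: c cT => [a|] cT; [apply: base | apply: (conn_step (@gs _ G') None cT)].
Qed.

Lemma conn_copies T m : None \in T -> gconn G' T (copy1 (Some m)) (copy2 (Some m)).
Proof. exact: (conn_step (@gs _ G') (copy1 (Some m))). Qed.

Lemma label_conn_rest T u u' :
  base_label G T (Some u) = base_label G T (Some u') -> gconn G' T (rest (Some u)) (rest (Some u')).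
Proof.
move/eqP; rewrite base_labelE => uu'; case DT: (None \in T); first exact: conn_restV.
have [->|neq] := eqVneq u u'; first exact: conn_refl.
have [[a|] aT] := conn_neq uu' neq; last by rewrite aT in DT.
by have /= := conn_rest (negbT DT) aT uu'.
Qed.

(** Labels are a complete invariant: they are constant along edges, and the rerouting lemmas give a
    path between vertices with equal labels. Residues of a stack are computed from labels from here
    on. *)
Lemma stack_connE T v w : gconn G' T v w = (stack_label T v == stack_label T w).
Proof.
apply/idP/eqP => [|e].
  apply: (conn_ind (P := fun w => stack_label T v = stack_label T w)) => // z c cT ->.
  by rewrite stack_label_step.
case DT: (None \in T).
  (* With the vertical colour each vertex of the second copy is joined to its twin, so only the
     first copy and [rest] remain to be compared. *)
  have red v1 : (exists x, gconn G' T v1 (copy1 x)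
        /\ stack_label T v1 = omap (fun A => inl (inl A)) (base_label H (horizontal T) x))
      \/ exists u, v1 = rest (Some u).
    case: v1 => [[[m|m]|u]|].
    - by left; exists (Some m); rewrite conn_refl /= DT.
    - by left; exists (Some m); rewrite connV conn_copies //= DT.
    - by right; exists u.
    - by left; exists None; rewrite conn_refl /= DT.
  have mixed x u : omap (fun A => inl (inl A)) (base_label H (horizontal T) x)
      = stack_label T (rest (Some u)) -> gconn G' T (copy1 x) (rest (Some u)).
    rewrite /=; case Ex: (base_label _ _ x) => [?|]; case Eu: (base_label _ _ _) => [?|] //= _.
    apply: (@conn_trans _ _ _ _ None).
      by rewrite connV; apply: (@conn_copy1 _ None); rewrite -base_label_eq0 Ex.
    have cu : gconn G T None (Some u) by rewrite -base_label_eq0 Eu.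
    exact: (conn_restV DT cu).
  case: (red v) (red w) e => [[x [vx ->]]|[u ->]] [[y [wy ->]]|[u' ->]] e.
  - apply: conn_trans vx _; rewrite connV; apply: conn_trans wy _.
    apply: conn_copy1; rewrite -base_labelE; apply/eqP.
    by move: e; case: (base_label _ _ x); case: (base_label _ _ y) => //= ? ? [->].
  - exact: conn_trans vx (mixed _ _ e).
  - by rewrite connV; apply: conn_trans wy (mixed _ _ (esym e)).
  - apply: label_conn_rest; move: e => /=.
    by case: (base_label _ _ _); case: (base_label _ _ _) => //= ? ? [->].
have mixed m u : stack_label T (copy2 (Some m)) = stack_label T (rest (Some u)) ->
    gconn G' T (copy2 (Some m)) (rest (Some u)).
  rewrite /= DT; case Em: (base_label _ _ (Some m)) => [?|];
    case Eu: (base_label _ _ _) => [?|] //= _.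
  have cm : gconn H (horizontal T) None (Some m) by rewrite -base_label_eq0 Em.
  have cu : gconn G T None (Some u) by rewrite -base_label_eq0 Eu.
  have [a] := conn_neq cm isT; rewrite inE => aT.
  by apply: conn_trans (conn_rest (negbT DT) aT cu); rewrite connV; apply: (conn_copy2 aT cm).
case: v w e => [[[m|m]|u]|] [[[m'|m']|u']|]; last first; try by rewrite connV.
all: rewrite /= ?DT.
- by move=> _; apply: conn_refl.
- by case: (base_label _ _ _).
- by case: (base_label _ _ _).
- by case=> /eqP; rewrite res_eqE; [apply: conn_copy1 | apply: gsK].
- by case: (base_label _ _ _).
- move=> e; apply: label_conn_rest; move: e.
  by case: (base_label _ _ _); case: (base_label _ _ _) => //= ? ? [->].
- by move=> e; rewrite connV; apply: mixed; rewrite /= DT.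
- by case: (base_label _ _ _).
- by case: (base_label _ _ _).
- by move=> e; apply: mixed; rewrite /= DT.
- move=> e; have {e} : gconn H (horizontal T) (Some m) (Some m').
    rewrite -base_labelE; apply/eqP; move: e.
    by case: (base_label _ _ _); case: (base_label _ _ _) => //= ? ? [->].
  have [-> _|neq cm] := eqVneq m m'; first exact: conn_refl.
  have [a] := conn_neq cm neq; rewrite inE => aT.
  exact: (conn_copy2 aT cm).
- by case: (base_label _ _ _).
- by case=> /eqP; rewrite res_eqE; [apply: conn_copy1 | apply: gsK].
- by case: (base_label _ _ _).
- by case: (base_label _ _ _).
- by case=> /eqP; rewrite res_eqE; [apply: conn_copy1 | apply: gsK].
Qed.

End StackResidues.

(** * Euler characteristics of a stack *)

Lemma card_imset_kernel (T1 T2 T3 : finType) (f : T1 -> T2) (g : T1 -> T3) (A : {set T1}) :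
    {in A &, forall x y, (f x == f y) = (g x == g y)} -> #|f @: A| = #|g @: A|.
Proof.
move=> fg; pose h y := omap g [pick x in A | f x == y].
rewrite -(card_imset (g @: A) Some_inj).
rewrite -(card_in_imset (f := h)).
  apply: eq_card => z; apply/imsetP/imsetP => [[_ /imsetP[x xA ->] ->]|[_ /imsetP[x xA ->] ->]].
    rewrite /h; case: pickP => [y /andP[yA]|/(_ x)]; last by rewrite xA eqxx.
    by rewrite fg // => /eqP gyx /=; exists (g y) => //; apply: imset_f.
  exists (f x); first exact: imset_f.
  rewrite /h; case: pickP => [y /andP[yA]|/(_ x)]; last by rewrite xA eqxx.
  by rewrite fg // => /eqP <-.
move=> _ _ /imsetP[x xA ->] /imsetP[y yA ->]; rewrite /h.
case: pickP => [x' /andP[x'A /eqP fx']|/(_ x)]; last by rewrite xA eqxx.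
case: pickP => [y' /andP[y'A /eqP fy']|/(_ y)]; last by rewrite yA eqxx.
by case=> /eqP; rewrite -fg // -fx' -fy' => /eqP.
Qed.

(** This counts labels in a connected sum: the two images share exactly [None]. *)
Lemma card_omapU (T1 T2 T : finType) (f : T1 -> T) (g : T2 -> T)
    (P : {set option T1}) (Q : {set option T2}) :
    injective f -> injective g -> (forall x y, f x != g y) ->
    None \in P -> None \in Q ->
  (#|omap f @: P :|: omap g @: Q| + 1)%N = (#|P| + #|Q|)%N.
Proof.
move=> fI gI fg P0 Q0.
have oI (T' : finType) (h : T' -> T) : injective h -> injective (omap h).
  by move=> hI [x|] [y|] //= [/hI->].
rewrite -(card_imset P (oI _ f fI)) -(card_imset Q (oI _ g gI)) -[RHS]cardsUI.
congr (_ + _)%N; rewrite -[LHS](cards1 (None : option T)); apply: eq_card => z.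
rewrite !inE; apply/eqP/andP => [->|[]].
  by split; apply/imsetP; exists None.
case/imsetP=> [[x|] _ ->] // /imsetP[[y|] _] //= [/eqP].
by rewrite (negPf (fg _ _)).
Qed.

(** The form of [spherical] with named colours, suited to distinguishing whether the vertical colour
    is among the three. *)
Definition spherical3 (K V : finType) (s : K -> V -> V) : Prop :=
  forall a b c x, a != b -> b != c -> a != c ->
  let A := res s [set a; b; c] x in
  (2 * (ncomp s [set a; b] A + ncomp s [set b; c] A + ncomp s [set a; c] A) = #|A| + 4)%N.

Lemma spherical3W (K V : finType) (s : K -> V -> V) : spherical3 s -> spherical s.
Proof.
move=> sS T x T3.
have [a [b [c [ab bc ac ->]]]] : exists a b c,
    [/\ a != b, b != c, a != c & T = [set a; b; c]].
  have /card_gt0P[a aT] : (0 < #|T|)%N by rewrite T3.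
  have := cardsD1 a T; rewrite aT T3 add1n => -[T2].
  have /card_gt0P[b] : (0 < #|T :\ a|)%N by rewrite -T2.
  move=> bT; have := cardsD1 b (T :\ a); rewrite bT -T2 add1n => -[/esym/eqP/cards1P[c Ec]].
  have cT : c \in T :\ a :\ b by rewrite Ec inE.
  move: bT cT; rewrite !inE => /andP[ba bT] /and3P[cb ca cT].
  exists a, b, c; split; rewrite 1?eq_sym //.
  apply/setP=> d; rewrite !inE; move/setP/(_ d): Ec; rewrite !inE.
  case: (d =P a) => [->|_]; first by rewrite aT.
case: (d =P b) => [->|_] /=; first by rewrite bT ?orbT.
  by move=> <-.
rewrite -sS //; congr (2 * _)%N.
have neq1 : [set a; c] != [set b; c].
  by apply: contraNneq ab => /setP/(_ a); rewrite !inE eqxx (negPf ac) ?orbF /= => <-.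
have neq2 : [set a; b] != [set b; c].
  by apply: contraNneq ab => /setP/(_ a); rewrite !inE eqxx (negPf ac) ?orbF /= => <-.
have neq3 : [set a; b] != [set a; c].
  by apply: contraNneq bc => /setP/(_ b); rewrite !inE eqxx orbT [b == a]eq_sym (negPf ab) /= => <-.
have E : [set [set a; b]; [set b; c]; [set a; c]]
    = [set S : {set K} | (S \subset [set a; b; c]) && (#|S| == 2)].
  apply/eqP; rewrite eqEcard cards_draws; apply/andP; split.
    apply/subsetP=> Q; rewrite !inE -orbA => /or3P[]/eqP->; rewrite cards2.
    + by rewrite ab subsetUl.
    + by rewrite bc -setUA subsetUr.
    + by rewrite ac setUAC subsetUl.
  have -> : #|[set a; b; c]| = 3.
    by rewrite setUC cardsU1 cards2 !inE ab (eq_sym c) (negPf ac) (eq_sym c) (negPf bc).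
  by rewrite setUC cardsU1 cards2 neq2 !inE (eq_sym _ [set a; b]) (negPf neq3) (negPf neq1).
rewrite (eq_bigl (fun S => S \in [set [set a; b]; [set b; c]; [set a; c]])); last first.
  by move=> S; rewrite E inE.
rewrite setUC big_setU1 /=; last by rewrite !inE (eq_sym _ [set a; b]) negb_or neq3 neq1.
by rewrite big_setU1 ?inE //= big_set1 addnC.
Qed.

(** Connected sum of two spheres: each of the three kinds of faces loses one by merging, and two
    vertices disappear. *)
Lemma euler_glued n1 n2 n3 h1 h2 h3 g1 g2 g3 h g n :
    n1 + 1 = h1 + g1 -> n2 + 1 = h2 + g2 -> n3 + 1 = h3 + g3 ->
    2 * (h1 + h2 + h3) = h + 4 -> 2 * (g1 + g2 + g3) = g + 4 -> n + 2 = h + g ->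
  2 * (n1 + n2 + n3) = n + 4.
Proof. lia. Qed.

(** Connected sum of a sphere with the prism over an [h]-gon: the lateral faces come from the
    [h / 2] edges of each colour; of the two horizontal faces one stays free and the other
    merges. *)
Lemma euler_base n1 n2 n3 h1 h3 g1 g2 g3 h g n :
    n1 + 1 = h1 + g1 -> n2 = 1 + g2 -> n3 + 1 = h3 + g3 ->
    h1 * 2 = h -> h3 * 2 = h -> 2 * (g1 + g2 + g3) = g + 4 -> n + 2 = 2 * h + g ->
  2 * (n1 + n2 + n3) = n + 4.
Proof. lia. Qed.

(** A prism over an [h]-gon has two horizontal faces and [h / 2] lateral ones for each of the two
    edge colours. *)
Lemma euler_prism n1 n2 n3 h1 h3 h n :
    n1 = h1 -> n2 = 2 -> n3 = h3 -> h1 * 2 = h -> h3 * 2 = h -> n = h + h ->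
  2 * (n1 + n2 + n3) = n + 4.
Proof. lia. Qed.

Section StackCount.
Variables (K : finType) (H : gem K) (G : gem (option K)).
Notation M := (gpt H).
Notation U := (gpt G).
Notation copy1 := (@copy1 K H G).
Notation copy2 := (@copy2 K H G).
Notation rest := (@rest K H G).
Notation G' := (stack H G).
Notation label := (@stack_label K H G).
Implicit Types (S T : {set option K}) (A : {set option M}) (B : {set option U}).

Lemma ncomp_label S (A : {set option (M + M + U)}) : ncomp (@gs _ G') S A = #|label S @: A|.
Proof.
apply: card_imset_kernel => x y _ _; rewrite -stack_connE res_eqE //; exact: gsK.
Qed.

Lemma ncomp_base_label K' (g : gem K') (S : {set K'}) (A : {set option (gpt g)}) :
  #|base_label g S @: A| = ncomp (@gs _ g) S A.
Proof.
apply: card_imset_kernel => x y _ _; rewrite base_labelE res_eqE //; exact: gsK.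
Qed.

(** Removing the base point from its residue loses no label: its neighbour along [a] still carries
    [None]. *)
Lemma base_label_imset0 K' (g : gem K') (T S : {set K'}) a : a \in S -> S \subset T ->
  let A := res (@gs _ g) T None in
  base_label g S @: (A :\ None) = base_label g S @: A /\ None \in base_label g S @: A.
Proof.
move=> aS sST A; have A0 : None \in A by apply: res_self.
split; last by apply/imsetP; exists None; rewrite ?base_label0.
apply/eqP; rewrite eqEsubset imsetS ?subsetDl //=; apply/subsetP=> _ /imsetP[x xA ->].
have [->|x0] := eqVneq x None; last by rewrite imset_f // in_setD1 x0 xA.
rewrite -(base_label_step None aS) imset_f // in_setD1 gsN res_closed //.
exact: (subsetP sST).
Qed.

Lemma mem_copy1 A w : (w \in copy1 @: A) =
  match w with None => None \in A | Some (inl (inl m)) => Some m \in A | _ => false end.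
Proof.
by apply/imsetP/idP => [[[m|] xA ->] //|]; case: w => [[[m|m]|u]|] // xA;
  [exists (Some m) | exists None].
Qed.

Lemma mem_copy2 A w : (w \in copy2 @: A) =
  match w with None => None \in A | Some (inl (inr m)) => Some m \in A | _ => false end.
Proof.
by apply/imsetP/idP => [[[m|] xA ->] //|]; case: w => [[[m|m]|u]|] // xA;
  [exists (Some m) | exists None].
Qed.

Lemma mem_rest B w : (w \in rest @: B) =
  match w with None => None \in B | Some (inr u) => Some u \in B | _ => false end.
Proof.
by apply/imsetP/idP => [[[m|] xA ->] //|]; case: w => [[[m|m]|u]|] // xA;
  [exists (Some u) | exists None].
Qed.

Lemma copy1_inj : injective copy1. Proof. by move=> [x|] [y|] //= [->]. Qed.
Lemma copy2_inj : injective copy2. Proof. by move=> [x|] [y|] //= [->]. Qed.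
Lemma rest_inj : injective rest. Proof. by move=> [x|] [y|] //= [->]. Qed.

Notation T0 T := (horizontal T).

Lemma stack_res_copy1 T x : None \notin T ->
  gres G' T (copy1 x) = copy1 @: gres H (T0 T) x.
Proof.
move=> DT; apply/setP=> w; rewrite mem_res stack_connE mem_copy1 /=.
have -> : label T (copy1 x) = Some (inl (inl (gres H (T0 T) x))).
  by case: x => [m|] /=; rewrite (negPf DT).
case: w => [[[m|m]|u]|] /=; rewrite ?(negPf DT) ?mem_res; last 1 first.
- by rewrite (inj_eq Some_inj) (inj_eq (@inl_inj _ _)) (inj_eq (@inl_inj _ _)) res_eqE //; apply: gsK.
- by rewrite (inj_eq Some_inj) (inj_eq (@inl_inj _ _)) (inj_eq (@inl_inj _ _)) res_eqE //; apply: gsK.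
- by case: (base_label _ _ _).
- by case: (base_label _ _ _).
Qed.

Lemma stack_res_copy2 T m : None \notin T -> ~~ gconn H (T0 T) None (Some m) ->
  gres G' T (copy2 (Some m)) = copy2 @: gres H (T0 T) (Some m).
Proof.
move=> DT Nm; apply/setP=> w; rewrite mem_res stack_connE mem_copy2 /= (negPf DT).
have [A EA] : exists A, base_label H (T0 T) (Some m) = Some A.
  by move: Nm; rewrite -base_label_eq0; case: (base_label _ _ _) => // A; exists A.
rewrite EA; case: w => [[[m'|m']|u]|] /=; rewrite ?(negPf DT) ?mem_res //.
- rewrite -base_labelE EA; case: (base_label _ _ _) => //= A'.
- by case: (base_label _ _ _).
- by rewrite (conn_sym (gsK H)) (negPf Nm).
Qed.

Lemma stack_res_rest T u : ~~ gconn G T None (Some u) ->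
  gres G' T (rest (Some u)) = rest @: gres G T (Some u).
Proof.
move=> Nu; apply/setP=> w; rewrite mem_res stack_connE mem_rest /=.
have [B EB] : exists B, base_label G T (Some u) = Some B.
  by move: Nu; rewrite -base_label_eq0; case: (base_label _ _ _) => // B; exists B.
rewrite EB; case: w => [[[m'|m']|u']|] /=; rewrite ?mem_res //.
- by case: (None \in T) => //; case: (base_label _ _ _).
- by case: (None \in T) => //; case: (base_label _ _ _).
- by rewrite -base_labelE EB; case: (base_label _ _ _).
- by rewrite (conn_sym (gsK G)) (negPf Nu) base_label0; case: (None \in T).
Qed.

Lemma stack_res_glued T v : None \notin T -> label T v = None ->
  gres G' T v = copy2 @: (gres H (T0 T) None :\ None) :|: rest @: (gres G T None :\ None).
Proof.
move=> DT Ev; apply/setP=> w; rewrite mem_res stack_connE Ev in_setU mem_copy2 mem_rest.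
case: w => [[[m'|m']|u']|] /=; rewrite ?(negPf DT) ?inE //= ?orbF.
- by rewrite -[in RHS]base_label_eq0; case: (base_label _ _ _).
- by rewrite -[in RHS]base_label_eq0; case: (base_label _ _ _).
Qed.

Lemma stack_res_prism T x : None \in T -> ~~ gconn H (T0 T) None x ->
  gres G' T (copy1 x) = copy1 @: gres H (T0 T) x :|: copy2 @: gres H (T0 T) x.
Proof.
move=> DT Nx; apply/setP=> w; rewrite mem_res stack_connE in_setU mem_copy1 mem_copy2.
have [A EA] : exists A, base_label H (T0 T) x = Some A.
  by move: Nx; rewrite -base_label_eq0; case: (base_label _ _ _) => // A; exists A.
have -> : label T (copy1 x) = Some (inl (inl A)).
  by case: x EA {Nx} => [m|] /= ->; rewrite DT.
case: w => [[[m'|m']|u]|] /=; rewrite ?DT ?mem_res ?orbF //=.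
- by rewrite -base_labelE EA; case: (base_label _ _ _).
- by rewrite -base_labelE EA; case: (base_label _ _ _).
- by case: (base_label _ _ _).
- by rewrite (conn_sym (gsK H)) (negPf Nx) base_label0.
Qed.

Lemma stack_res_base T v : None \in T -> label T v = None ->
  gres G' T v = copy1 @: gres H (T0 T) None :|: copy2 @: (gres H (T0 T) None :\ None)
                :|: rest @: (gres G T None :\ None).
Proof.
move=> DT Ev; apply/setP=> w; rewrite mem_res stack_connE Ev !in_setU mem_copy1 mem_copy2 mem_rest.
case: w => [[[m'|m']|u']|] /=; rewrite ?DT ?inE //= ?orbF.
- by rewrite -[in RHS]base_label_eq0; case: (base_label _ _ _).
- by rewrite -[in RHS]base_label_eq0; case: (base_label _ _ _).
- by rewrite -[in RHS]base_label_eq0; case: (base_label _ _ _).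
- by rewrite base_label0 conn_refl.
Qed.

Lemma ncomp_copy1 S A : None \notin S -> ncomp (@gs _ G') S (copy1 @: A) = ncomp (@gs _ H) (T0 S) A.
Proof.
move=> DS; rewrite /ncomp -imset_comp; apply: card_imset_kernel => x y _ _ /=.
rewrite (stack_res_copy1 _ DS) (stack_res_copy1 _ DS) (inj_eq (imset_inj copy1_inj)) //.
Qed.

Lemma ncomp_copy2 S A : None \notin S ->
    {in A, forall x, ~~ gconn H (T0 S) None x} ->
  ncomp (@gs _ G') S (copy2 @: A) = ncomp (@gs _ H) (T0 S) A.
Proof.
move=> DS AN; rewrite /ncomp -imset_comp; apply: card_imset_kernel => x y xA yA /=.
case: x y xA yA => [m|] [m'|] /AN Nx /AN Ny; rewrite ?conn_refl // in Nx Ny.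
by rewrite !stack_res_copy2 // (inj_eq (imset_inj copy2_inj)).
Qed.

Lemma ncomp_rest S B : {in B, forall x, ~~ gconn G S None x} ->
  ncomp (@gs _ G') S (rest @: B) = ncomp (@gs _ G) S B.
Proof.
move=> BN; rewrite /ncomp -imset_comp; apply: card_imset_kernel => x y xA yA /=.
case: x y xA yA => [m|] [m'|] /BN Nx /BN Ny; rewrite ?conn_refl // in Nx Ny.
by rewrite !stack_res_rest // (inj_eq (imset_inj rest_inj)).
Qed.

Lemma label_copy2 S A : None \notin A ->
  label S @: (copy2 @: A) =
  omap (fun A => inl (if None \in S then inl A else inr A)) @: (base_label H (T0 S) @: A).
Proof.
move=> A0; rewrite -!imset_comp; apply: eq_in_imset => -[m|] mA /=; last by rewrite mA in A0.
by case: (None \in S).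
Qed.

Lemma label_rest S B : None \notin B ->
  label S @: (rest @: B) = omap inr @: (base_label G S @: B).
Proof.
move=> B0; rewrite -!imset_comp; apply: eq_in_imset => -[u|] uB //=; by rewrite uB in B0.
Qed.

(** Because of the colour [a] both pieces keep a class labelled [None] after the removal, and these
    two classes are the only ones that merge. *)
Lemma ncomp_glued T S a : None \notin T -> Some a \in S -> S \subset T ->
  let A := gres H (T0 T) None in let B := gres G T None in
  (ncomp (@gs _ G') S (copy2 @: (A :\ None) :|: rest @: (B :\ None)) + 1)%N
  = (ncomp (@gs _ H) (T0 S) A + ncomp (@gs _ G) S B)%N.
Proof.
move=> DT aS sST A B; have DS : None \notin S by apply: contra DT; apply: (subsetP sST).
have aS0 : a \in T0 S by rewrite inE.
have sST0 : T0 S \subset T0 T.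
  by apply/subsetP=> b; rewrite !inE; apply: (subsetP sST).
have [EA nA] := base_label_imset0 H aS0 sST0; have [EB nB] := base_label_imset0 G aS sST.
rewrite ncomp_label imsetU label_copy2 ?label_rest ?inE ?eqxx // EA EB (negPf DS).
rewrite card_omapU //; last first.
- by move=> x y [].
- by move=> x y [].
by rewrite !ncomp_base_label.
Qed.

Lemma label_copy1 S A : None \notin S ->
  label S @: (copy1 @: A) = (fun A => Some (inl (inl A))) @: (gres H (T0 S) @: A).
Proof.
move=> DS; rewrite -!imset_comp; apply: eq_imset => -[m|] /=; by rewrite (negPf DS).
Qed.

Lemma label_copy1V S A : None \in S ->
  label S @: (copy1 @: A) = omap (fun A => inl (inl A)) @: (base_label H (T0 S) @: A).
Proof.
move=> DS; rewrite -!imset_comp; apply: eq_imset => -[m|] /=; by rewrite DS.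
Qed.

Lemma imset_res K' (g : gem K') (S : {set K'}) x :
  gres g S @: gres g S x = [set gres g S x].
Proof.
apply/setP=> A; rewrite inE; apply/imsetP/eqP => [[y]|->].
  by rewrite mem_res => xy ->; apply/esym/res_eq => //; apply: gsK.
by exists x; rewrite ?res_self.
Qed.

Lemma imset_base_label K' (g : gem K') (S : {set K'}) x :
  base_label g S @: gres g S x = [set base_label g S x].
Proof.
apply/setP=> A; rewrite inE; apply/imsetP/eqP => [[y]|->].
  by rewrite mem_res => xy ->; apply/esym/eqP; rewrite base_labelE.
by exists x; rewrite ?res_self.
Qed.

Lemma ncomp_prism S x : None \notin S -> ~~ gconn H (T0 S) None x ->
  let C := gres H (T0 S) x in
  ncomp (@gs _ G') S (copy1 @: C :|: copy2 @: C) = 2.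
Proof.
move=> DS Nx C; have C0 : None \notin C by rewrite mem_res (conn_sym (gsK H)).
rewrite ncomp_label imsetU label_copy1 // label_copy2 // (negPf DS) imset_res imset_base_label.
by rewrite /base_label (negPf Nx) !imset_set1 cards2.
Qed.

Lemma ncomp_prismV S A : None \in S -> None \notin A ->
  ncomp (@gs _ G') S (copy1 @: A :|: copy2 @: A) = ncomp (@gs _ H) (T0 S) A.
Proof.
move=> DS A0; rewrite ncomp_label imsetU label_copy1V // label_copy2 // DS setUid.
rewrite card_imset ?ncomp_base_label // => -[x|] [y|] //= [->] //.
Qed.

(** The horizontal face on the first copy is free; the one on the second copy shares the label
    [None] with the face of [G] at its base point. *)
Lemma ncomp_base T S a : None \notin S -> T0 S = T0 T -> Some a \in S -> S \subset T ->
  let A := gres H (T0 T) None in let B := gres G T None in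
  ncomp (@gs _ G') S (copy1 @: A :|: copy2 @: (A :\ None) :|: rest @: (B :\ None))
  = (1 + ncomp (@gs _ G) S B)%N.
Proof.
move=> DS eST aS sST A B; rewrite /A -eST.
have [EB nB] := base_label_imset0 G aS sST.
have aS0 : a \in T0 S by rewrite inE.
have [EA _] := base_label_imset0 H aS0 (subxx _).
rewrite ncomp_label !imsetU label_copy1 // label_copy2 ?label_rest ?inE ?eqxx //.
rewrite (negPf DS) EA EB imset_res imset_base_label base_label0 !imset_set1 /=.
set Q := omap inr @: _; have Q0 : None \in Q by apply/imsetP; exists None.
rewrite -setUA (_ : [set None] :|: Q = Q); last by apply/setUidPr; rewrite sub1set.
rewrite cardsU1 card_imset; last by move=> [x|] [y|] //= [->].
rewrite ncomp_base_label; congr (_ + _)%N.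
by apply/eqP; rewrite eqb1; apply/imsetP=> -[[y|]].
Qed.

Lemma ncomp_baseV T S a : None \in S -> Some a \in S -> S \subset T ->
  let A := gres H (T0 T) None in let B := gres G T None in
  (ncomp (@gs _ G') S (copy1 @: A :|: copy2 @: (A :\ None) :|: rest @: (B :\ None)) + 1)%N
  = (ncomp (@gs _ H) (T0 S) A + ncomp (@gs _ G) S B)%N.
Proof.
move=> DS aS sST A B.
have aS0 : a \in T0 S by rewrite inE.
have sST0 : T0 S \subset T0 T.
  by apply/subsetP=> b; rewrite !inE; apply: (subsetP sST).
have [EA nA] := base_label_imset0 H aS0 sST0; have [EB nB] := base_label_imset0 G aS sST.
rewrite ncomp_label !imsetU label_copy1V ?label_copy2 ?label_rest ?inE ?eqxx // EA EB DS setUid.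
rewrite card_omapU ?ncomp_base_label //; by move=> x y [].
Qed.

Lemma horizontal2 (a b : K) : T0 [set Some a; Some b] = [set a; b].
Proof. by apply/setP=> c; rewrite !inE. Qed.

Lemma horizontal3 (a b c : K) : T0 [set Some a; Some b; Some c] = [set a; b; c].
Proof. by apply/setP=> d; rewrite !inE. Qed.

Lemma horizontal_vertical2 (a : K) : T0 [set None; Some a] = [set a].
Proof. by apply/setP=> d; rewrite !inE. Qed.

Lemma horizontal_vertical3 (a b : K) : T0 [set None; Some a; Some b] = [set a; b].
Proof. by apply/setP=> d; rewrite !inE. Qed.

Lemma card_base_del K' (g : gem K') (S : {set K'}) :
  #|gres g S None| = #|gres g S None :\ None|.+1.
Proof. by rewrite (cardsD1 None) res_self. Qed.

Lemma card_copy1 A : #|copy1 @: A| = #|A|.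
Proof. exact/card_imset/copy1_inj. Qed.
Lemma card_copy2 A : #|copy2 @: A| = #|A|.
Proof. exact/card_imset/copy2_inj. Qed.
Lemma card_rest B : #|rest @: B| = #|B|.
Proof. exact/card_imset/rest_inj. Qed.

Lemma copies_disjoint A A' : None \notin A' -> copy1 @: A :&: copy2 @: A' = set0.
Proof.
by move=> A0; apply/setP=> w; rewrite !inE mem_copy1 mem_copy2;
  case: w => [[[m|m]|u]|]; rewrite ?andbF // (negPf A0) andbF.
Qed.

Lemma rest_disjoint A A' B : None \notin B -> (copy1 @: A :|: copy2 @: A') :&: rest @: B = set0.
Proof.
by move=> A0; apply/setP=> w; rewrite !inE mem_copy1 mem_copy2 mem_rest;
  case: w => [[[m|m]|u]|]; rewrite ?andbF // (negPf A0) andbF.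
Qed.

Lemma notin_res K' (g : gem K') (S T : {set K'}) x : S \subset T ->
  ~~ gconn g T None x -> {in gres g T x, forall y, ~~ gconn g S None y}.
Proof.
move=> sST Nx y; rewrite mem_res => xy; apply: contra Nx => /(conn_sub sST).
by move/conn_trans; apply; rewrite (conn_sym (gsK g)).
Qed.

(** The four shapes of a residue: the one where the connected sum takes place, one meeting the first
    copy (a prism if the vertical colour is present), one inside the second copy, and one inside
    [rest]. *)
Variant stack_label_spec T v : Prop :=
| OnBase of label T v = None
| OnCopy1 x of gconn G' T v (copy1 x) & (None \notin T) || ~~ gconn H (T0 T) None x
| OnCopy2 m of v = copy2 (Some m) & None \notin T & ~~ gconn H (T0 T) None (Some m)
| OnOld u of v = rest (Some u) & ~~ gconn G T None (Some u).

Lemma stack_labelP T v : stack_label_spec T v.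
Proof.
case E: (label T v) => [l|]; last exact: OnBase.
case: v E => [[[m|m]|u]|] /= E.
- apply: (OnCopy1 (x := Some m)); first exact: conn_refl.
  move: E; case: (None \in T) => //=.
  by rewrite -base_label_eq0; case: (base_label _ _ _).
- case DT: (None \in T) E => E.
    apply: (OnCopy1 (x := Some m)); first by rewrite connV conn_copies.
    by rewrite DT -base_label_eq0; case: (base_label H _ (Some m)) E.
  apply: (OnCopy2 (m := m)); rewrite ?DT //.
  by rewrite -base_label_eq0; case: (base_label H _ (Some m)) E.
- by apply: (OnOld (u := u)) => //; move: E; rewrite -base_label_eq0; case: (base_label _ _ _).
- apply: (OnCopy1 (x := None)); first exact: conn_refl.
  by move: E; rewrite base_label0; case: (None \in T).
Qed.

Hypotheses (sH : spherical3 (@gs _ H)) (sG : spherical3 (@gs _ G)).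

Lemma spherical_rest (a b c : option K) u : a != b -> b != c -> a != c ->
  let T := [set a; b; c] in ~~ gconn G T None (Some u) ->
  let A := gres G' T (rest (Some u)) in
  (2 * (ncomp (@gs _ G') [set a; b] A + ncomp (@gs _ G') [set b; c] A
        + ncomp (@gs _ G') [set a; c] A) = #|A| + 4)%N.
Proof.
move=> ab bc ac T Nu; rewrite stack_res_rest //=.
rewrite !ncomp_rest ?card_rest; first exact: sG.
- by apply: notin_res Nu; rewrite /T setUAC subsetUl.
- by apply: notin_res Nu; rewrite /T -setUA subsetUr.
- by apply: notin_res Nu; rewrite /T subsetUl.
Qed.

Lemma spherical_horizontal a b c v : a != b -> b != c -> a != c ->
  let A := gres G' [set Some a; Some b; Some c] v in
  (2 * (ncomp (@gs _ G') [set Some a; Some b] A + ncomp (@gs _ G') [set Some b; Some c] A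
        + ncomp (@gs _ G') [set Some a; Some c] A) = #|A| + 4)%N.
Proof.
move=> ab bc ac; set T := [set Some a; Some b; Some c].
have DT : None \notin T by rewrite !inE.
have D2 e f : None \notin [set Some e; Some f] by rewrite !inE.
have ET : T0 T = [set a; b; c] by apply: horizontal3.
have s1 : [set Some a; Some b] \subset T by rewrite subsetUl.
have s2 : [set Some b; Some c] \subset T by rewrite /T -setUA subsetUr.
have s3 : [set Some a; Some c] \subset T by rewrite /T setUAC subsetUl.
have [E|x vx _|m -> _ Nm|u -> Nu] := stack_labelP T v.
- have card2 : (#|gres G' T v| + 2 = #|gres H (T0 T) None| + #|gres G T None|)%N.
    rewrite stack_res_glued // cardsU card_copy2 card_rest.
    have := @rest_disjoint set0 (gres H (T0 T) None :\ None) (gres G T None :\ None).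
    rewrite imset0 set0U => ->; last by rewrite !inE.
    by rewrite cards0 subn0 (card_base_del H) (card_base_del G) addn2 addSn addnS.
  move: card2; rewrite /= stack_res_glued //= => card2.
  apply: (euler_glued _ _ _ _ (@sG (Some a) (Some b) (Some c) None ab bc ac) card2).
  + by rewrite (ncomp_glued DT (set21 _ _) s1) horizontal2.
  + by rewrite (ncomp_glued DT (set21 _ _) s2) horizontal2.
  + by rewrite (ncomp_glued DT (set21 _ _) s3) horizontal2.
  + by rewrite ET; apply: sH.
- rewrite (res_eq (gsK G') vx) stack_res_copy1 //= !ncomp_copy1 // card_copy1 !horizontal2 ET.
  exact: sH.
- rewrite stack_res_copy2 //= !ncomp_copy2 // ?card_copy2 ?horizontal2 ET; first exact: sH.
  + by apply: notin_res; rewrite -?ET // ET setUAC subsetUl.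
  + by apply: notin_res; rewrite -?ET // ET -setUA subsetUr.
  + by apply: notin_res; rewrite -?ET // ET subsetUl.
- by apply: spherical_rest.
Qed.

Lemma spherical_vertical a b v : a != b ->
  let A := gres G' [set None; Some a; Some b] v in
  (2 * (ncomp (@gs _ G') [set None; Some a] A + ncomp (@gs _ G') [set Some a; Some b] A
        + ncomp (@gs _ G') [set None; Some b] A) = #|A| + 4)%N.
Proof.
move=> ab; set T := [set None; Some a; Some b].
have DT : None \in T by rewrite !inE.
have D2 : None \notin [set Some a; Some b] by rewrite !inE.
have ET : T0 T = [set a; b] by apply: horizontal_vertical3.
have s1 : [set None; Some a] \subset T by rewrite subsetUl.
have s2 : [set Some a; Some b] \subset T by rewrite /T -setUA subsetUr.
have s3 : [set None; Some b] \subset T by rewrite /T setUAC subsetUl.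
have ea x := ncomp_res_edge (gsK H) (gsN H) x (set21 a b).
have eb x := ncomp_res_edge (gsK H) (gsN H) x (set22 a b).
have [E|x vx|m _|u -> Nu] := stack_labelP T v; last 2 first.
- by rewrite DT.
- by apply: spherical_rest.
- have card2 : (#|gres G' T v| + 2 = 2 * #|gres H (T0 T) None| + #|gres G T None|)%N.
    rewrite stack_res_base // cardsU rest_disjoint ?inE // cardsU copies_disjoint ?inE //.
    rewrite card_copy1 card_copy2 card_rest cards0 !subn0 (card_base_del H) (card_base_del G).
    by have arith p q : (p.+1 + p + q + 2 = 2 * p.+1 + q.+1)%N by lia; apply: arith.
  move: card2; rewrite /= stack_res_base //= => card2.
  apply: (euler_base _ _ _ _ _ (@sG None (Some a) (Some b) None isT ab isT) card2).
  + by rewrite (ncomp_baseV (set21 _ _) (set22 _ _) s1) horizontal_vertical2.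
  + by rewrite (ncomp_base D2 _ (set21 _ _) s2) // horizontal2.
  + by rewrite (ncomp_baseV (set21 _ _) (set22 _ _) s3) horizontal_vertical2.
  + by rewrite ET; apply: ea.
  + by rewrite ET; apply: eb.
rewrite DT /= => Nx; rewrite (res_eq (gsK G') vx) stack_res_prism //=.
have C0 : None \notin gres H [set a; b] x by rewrite mem_res (conn_sym (gsK H)) -ET.
have E2 : T0 T = T0 [set Some a; Some b] by rewrite ET horizontal2.
have N2 : ncomp (@gs _ G') [set Some a; Some b]
    (copy1 @: gres H (T0 T) x :|: copy2 @: gres H (T0 T) x) = 2.
  by rewrite E2 ncomp_prism // -E2.
apply: (euler_prism _ N2 _ (ea x) (eb x)).
- by rewrite ncomp_prismV ?set21 ?ET // horizontal_vertical2.
- by rewrite ncomp_prismV ?set21 ?ET // horizontal_vertical2.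
- by rewrite ET cardsU copies_disjoint // card_copy1 card_copy2 cards0 subn0.
Qed.

Lemma stack_spherical : spherical3 (@gs _ G').
Proof.
move=> [a|] [b|] [c|] v ab bc ac //=.
- exact: spherical_horizontal.
- rewrite (setUC [set Some a; Some b]) setUA (setUC [set Some a] [set None]).
  by rewrite (setUC [set Some b] [set None]) addnC addnA; apply: spherical_vertical.
- by rewrite (setUC [set Some a] [set None]) addnAC; apply: spherical_vertical.
- exact: spherical_vertical.
Qed.

Lemma stack_connected : connected (@gs _ H) -> connected (@gs _ G) -> connected (@gs _ G').
Proof.
move=> cH cG; have T0T : T0 [set: option K] = [set: K] by apply/setP=> a; rewrite !inE.
have lab0 v : label setT v = None.
  have bH x : base_label H setT x = None by apply/eqP; rewrite base_label_eq0.
  have bG x : base_label G setT x = None by apply/eqP; rewrite base_label_eq0.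
  by case: v => [[[m|m]|u]|] /=; rewrite ?inE ?T0T ?bH ?bG.
by move=> v w; rewrite stack_connE !lab0.
Qed.

End StackCount.

Local Open Scope ring_scope.

(** * Words and cell codes *)

Lemma F2P (x : 'F_2) : x = 0 \/ x = 1.
Proof. by case: x => -[|[|//]] i; [left|right]; apply: val_inj. Qed.

Lemma F2_add (x : 'F_2) : x + x = 0.
Proof. by case: (F2P x) => ->; apply: val_inj. Qed.

Lemma F2_natr n : n%:R = (odd n)%:R :> 'F_2.
Proof.
elim: n => //= n IH; rewrite -natr1 IH; case: (odd n) => /=; last by rewrite add0r.
exact: F2_add.
Qed.

Lemma F2_natr_eq0 n : ((n%:R : 'F_2) == 0) = ~~ odd n.
Proof. by rewrite F2_natr; case: (odd n). Qed.

Notation word U := {ffun U -> 'F_2}.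

Section Words.
Variable U : finType.
Implicit Types (x y z w : word U) (P : word U -> Prop).

Definition weight w : nat := #|[set u | w u != 0]|.
Definition dot x y : 'F_2 := \sum_u x u * y u.
Definition cst b : word U := [ffun=> b].
Definition indicator (A : {set option U}) : word U := [ffun u => (Some u \in A)%:R].

Lemma word_add w : w + w = 0.
Proof. by apply/ffunP=> u; rewrite !ffunE F2_add. Qed.

Lemma cst0 : cst 0 = 0. Proof. by apply/ffunP=> u; rewrite !ffunE. Qed.

Lemma dotC x y : dot x y = dot y x.
Proof. by apply: eq_bigr => u _; rewrite mulrC. Qed.

Lemma dotDl x y z : dot (x + y) z = dot x z + dot y z.
Proof. by rewrite /dot -big_split; apply: eq_bigr => u _; rewrite ffunE mulrDl. Qed.

Lemma dotDr x y z : dot z (x + y) = dot z x + dot z y.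
Proof. by rewrite !(dotC z) dotDl. Qed.

Lemma dot0l x : dot 0 x = 0.
Proof. by apply: big1 => u _; rewrite ffunE mul0r. Qed.

Lemma dot0r x : dot x 0 = 0.
Proof. by rewrite dotC dot0l. Qed.

Lemma weightE w : weight w = (\sum_u (w u != 0%R))%N.
Proof. by rewrite /weight -sum1dep_card big_mkcond; apply: eq_bigr => u _; case: (_ != _). Qed.

Lemma dot_weight w : dot w (cst 1) = (weight w)%:R.
Proof.
rewrite weightE natr_sum; apply: eq_bigr => u _; rewrite ffunE mulr1.
by case: (F2P (w u)) => ->.
Qed.

Lemma dot_cst w b : dot w (cst b) = b * (weight w)%:R.
Proof.
rewrite -dot_weight mulr_sumr; apply: eq_bigr => u _; rewrite !ffunE mulr1 mulrC //.
Qed.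

Lemma weight_cst1 : weight (cst 1) = #|U|.
Proof. by rewrite weightE -sum1_card; apply: eq_bigr => u _; rewrite ffunE. Qed.

Lemma weight0 : weight 0 = 0%N.
Proof. by rewrite weightE big1 // => u _; rewrite ffunE eqxx. Qed.

Lemma weightC w : (weight w + weight (w + cst 1)%R = #|U|)%N.
Proof.
rewrite !weightE -big_split -sum1_card; apply: eq_bigr => u _; rewrite !ffunE /=.
by case: (F2P (w u)) => ->.
Qed.

Lemma weight_add x y : (weight (x + y)%R <= weight x + weight y)%N.
Proof.
rewrite !weightE -big_split; apply: leq_sum => u _; rewrite !ffunE /=.
by case: (F2P (x u)) => ->; case: (F2P (y u)) => ->.
Qed.

Lemma odd_weight_add x y : odd (weight (x + y)) = odd (weight x) (+) odd (weight y).
Proof.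
apply: negb_inj; rewrite -oddD -!F2_natr_eq0 natrD -!dot_weight dotDl //.
Qed.

(** Over F_2 a span consists of sums of generators; the inductive form gives induction on generators
    without coordinates. *)
Inductive span P : word U -> Prop :=
| span0 : span P 0
| spanD x y : P x -> span P y -> span P (x + y).

Lemma span_gen P x : P x -> span P x.
Proof. by move=> Px; rewrite -[x]addr0; apply: spanD Px (span0 P). Qed.

Lemma span_add P x y : span P x -> span P y -> span P (x + y).
Proof.
by move=> Px Py; elim: Px => [|z t Pz _ IH]; rewrite ?add0r // -addrA; apply: spanD.
Qed.

Lemma span_sum P (I : finType) (Q : pred I) F :
  (forall i, Q i -> P (F i)) -> span P (\sum_(i | Q i) F i).
Proof.
move=> PF; apply: (big_ind (span P)) => [||i /PF]; first exact: span0.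
  exact: span_add.
exact: span_gen.
Qed.

Lemma span_dot P x z : (forall y, P y -> dot y z = 0) -> span P x -> dot x z = 0.
Proof.
by move=> Pz; elim=> [|y t /Pz Py _ IH]; rewrite ?dot0l // dotDl Py IH addr0.
Qed.

Lemma span_ind_add P (Q : word U -> Prop) : Q 0 -> (forall x y, Q x -> Q y -> Q (x + y)) ->
  (forall x, P x -> Q x) -> forall x, span P x -> Q x.
Proof. by move=> Q0 QD PQ x; elim=> // y z Py _ Qz; apply: QD => //; apply: PQ. Qed.

End Words.

Arguments cst {U} b.

Section Triples.
Variables M U : finType.
Implicit Types (x y : word M) (z : word U) (w : word (M + M + U)).

Definition triple x y z : word (M + M + U) :=
  [ffun s => match s with inl (inl m) => x m | inl (inr m) => y m | inr u => z u end].

Lemma tripleP w : exists x y z, w = triple x y z.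
Proof.
exists [ffun m => w (inl (inl m))], [ffun m => w (inl (inr m))], [ffun u => w (inr u)].
by apply/ffunP=> -[[m|m]|u]; rewrite !ffunE.
Qed.

Lemma tripleD x y z x' y' z' :
  triple x y z + triple x' y' z' = triple (x + x') (y + y') (z + z').
Proof. by apply/ffunP=> -[[m|m]|u]; rewrite !ffunE. Qed.

Lemma triple0 : triple 0 0 0 = 0.
Proof. by apply/ffunP=> -[[m|m]|u]; rewrite !ffunE. Qed.

Lemma triple_cst b : triple (cst b) (cst b) (cst b) = cst b.
Proof. by apply/ffunP=> -[[m|m]|u]; rewrite !ffunE. Qed.

Lemma dot_triple x y z x' y' z' :
  dot (triple x y z) (triple x' y' z') = dot x x' + dot y y' + dot z z'.
Proof.
rewrite /dot !big_sumType /=; congr (_ + _ + _); apply: eq_bigr => u _; by rewrite !ffunE.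
Qed.

Lemma weight_triple x y z : weight (triple x y z) = (weight x + weight y + weight z)%N.
Proof.
rewrite !weightE !big_sumType /=; congr (_ + _ + _)%N; apply: eq_bigr => u _; by rewrite !ffunE.
Qed.

End Triples.

Section CellCodes.
Variables (K : finType) (G : gem K).

Definition cell_word m (w : word (gpt G)) : Prop :=
  exists (T : {set K}) x, [/\ #|T| = m, ~~ gconn G T None x & w = indicator (gres G T x)].

Definition cell_code m : word (gpt G) -> Prop := span (cell_word m).

(** The residues for [T] partition the vertices, so those avoiding the base point sum to the
    complement of the one through it. *)
Lemma cell_code_base (T : {set K}) : cell_code #|T| (cst 1 + indicator (gres G T None)).
Proof.
rewrite (_ : _ + _ = \sum_(A in gres G T @: [set x | ~~ gconn G T None x]) indicator A).
  by apply: span_sum => _ /imsetP[x + ->]; rewrite inE => Nx; exists T, x.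
apply/ffunP=> u; rewrite !ffunE mem_res sum_ffunE.
case cu: (gconn G T None (Some u)) => /=.
  rewrite F2_add big1 // => _ /imsetP[x + ->]; rewrite inE ffunE mem_res => Nx.
  case: (boolP (gconn _ _ _ _)) => // xu; case/negP: Nx.
  by apply: conn_trans cu _; rewrite (conn_sym (gsK G)).
rewrite addr0 (bigD1 (gres G T (Some u))) /=; last by apply: imset_f; rewrite inE cu.
rewrite ffunE res_self big1 ?addr0 // => _ /andP[/imsetP[x _ ->]].
rewrite ffunE mem_res => ne; case: (boolP (gconn _ _ _ _)) => // xu.
by case/eqP: ne; apply: res_eq => //; apply: gsK.
Qed.

End CellCodes.
Arguments cell_word {K} G m w.
Arguments cell_code {K} G m w.

(** * Stabilizers of a stack as triples of words *)

Section StackCode.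
Variables (K : finType) (H : gem K) (G : gem (option K)).
Notation M := (gpt H).
Notation U := (gpt G).
Notation copy1 := (@copy1 K H G).
Notation copy2 := (@copy2 K H G).
Notation rest := (@rest K H G).
Notation G' := (stack H G).
Implicit Types (T : {set option K}) (S : {set K}) (A : {set option M}) (B : {set option U}).

Lemma horizontal_some S : horizontal (Some @: S) = S.
Proof. by apply/setP=> a; rewrite inE mem_imset //; apply: Some_inj. Qed.

Lemma none_some S : None \notin Some @: S.
Proof. by apply/imsetP=> -[]. Qed.

Lemma horizontal_vertical S : horizontal (None |: Some @: S) = S.
Proof. by apply/setP=> a; rewrite !inE mem_imset //; apply: Some_inj. Qed.

Lemma some_horizontal T : None \notin T -> Some @: horizontal T = T.
Proof.
move=> DT; apply/setP=> -[a|]; last by rewrite (negPf DT) (negPf (none_some _)).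
by rewrite mem_imset ?inE //; apply: Some_inj.
Qed.

Lemma vertical_horizontal T : None \in T -> None |: Some @: horizontal T = T.
Proof.
move=> DT; apply/setP=> -[a|]; last by rewrite !inE DT.
by rewrite !inE mem_imset ?inE //; apply: Some_inj.
Qed.

Lemma indicator_copy1 A : indicator (copy1 @: A) = triple (indicator A) 0 0.
Proof. by apply/ffunP=> -[[m|m]|u]; rewrite !ffunE mem_copy1. Qed.

Lemma indicator_rest B : indicator (rest @: B) = triple 0 0 (indicator B).
Proof. by apply/ffunP=> -[[m|m]|u]; rewrite !ffunE mem_rest. Qed.

Lemma indicator_prism A : indicator (copy1 @: A :|: copy2 @: A) = triple (indicator A) (indicator A) 0.
Proof. by apply/ffunP=> -[[m|m]|u]; rewrite !ffunE in_setU mem_copy1 mem_copy2 ?orbF. Qed.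

Lemma indicator_glued A B : indicator (copy2 @: (A :\ None) :|: rest @: (B :\ None))
  = triple 0 (indicator A) (indicator B).
Proof.
by apply/ffunP=> -[[m|m]|u]; rewrite !ffunE in_setU mem_copy2 mem_rest ?in_setD1 ?orbF.
Qed.

Lemma mem_base_res K' (g : gem K') (S : {set K'}) v :
  (None \in gres g S v) = gconn g S None v.
Proof. by rewrite mem_res conn_sym //; apply: gsK. Qed.

Lemma cell_word_old m g : cell_word G m g -> cell_word G' m (triple 0 0 g).
Proof.
case=> T [[u|] [Tm Nu ->]]; last by rewrite conn_refl in Nu.
exists T, (rest (Some u)).
by rewrite -mem_base_res stack_res_rest // mem_rest mem_base_res indicator_rest.
Qed.

Lemma cell_word_copy1 m f : cell_word H m f -> cell_word G' m (triple f 0 0).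
Proof.
case=> S [x [Tm Nx ->]]; exists (Some @: S), (copy1 x).
rewrite -mem_base_res stack_res_copy1 ?none_some // mem_copy1 mem_base_res horizontal_some indicator_copy1.
by rewrite card_imset //; apply: Some_inj.
Qed.

Lemma cell_word_prism m c : cell_word H m c -> cell_word G' m.+1 (triple c c 0).
Proof.
case=> S [x [Tm Nx ->]]; exists (None |: Some @: S), (copy1 x).
rewrite -mem_base_res stack_res_prism ?horizontal_vertical ?setU11 //.
rewrite in_setU mem_copy1 mem_copy2 mem_base_res indicator_prism (negPf Nx).
by rewrite cardsU1 none_some card_imset ?Tm //; apply: Some_inj.
Qed.

Lemma cell_word_glued S a : a \in S ->
  cell_word G' #|S| (triple 0 (indicator (gres H S None)) (indicator (gres G (Some @: S) None))).
Proof.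
move=> aT; have [m Em] := gs_base H a; exists (Some @: S), (copy2 (Some m)).
rewrite -mem_base_res stack_res_glued ?none_some //; last first.
  rewrite /= (negPf (none_some _)) horizontal_some -Em base_label_step //.
  by rewrite base_label0.
rewrite in_setU mem_copy2 mem_rest !inE eqxx horizontal_some indicator_glued.
by rewrite card_imset //; apply: Some_inj.
Qed.

Hypothesis cH : connected (@gs _ H).

(** A cell with the vertical colour is a prism or lies in [rest]. One without it has all horizontal
    colours, which connect [H], so it is the glued cell or lies in [rest]; the first copy is the
    cell at the puncture. *)
Lemma cell_word_stack w : cell_word G' #|K| w ->
  [\/ exists2 g, cell_word G #|K| g & w = triple 0 0 g,
      exists2 c, cell_word H #|K|.-1 c & w = triple c c 0
    | exists2 T : {set option K}, #|T| = #|K| & w = triple 0 (cst 1) (indicator (gres G T None))].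
Proof.
case=> T [v [TK Nv ->]]; case DT: (None \in T); last first.
  have E0 : horizontal T = setT.
    apply/eqP; rewrite eqEcard subsetT cardsT -TK -(some_horizontal (negbT DT)).
    by rewrite card_imset ?horizontal_some ?leqnn //; apply: Some_inj.
  have [E|x vx _|m vE _ Nm|u vE Nu] := stack_labelP T v.
  - constructor 3; exists T => //; rewrite stack_res_glued ?DT // indicator_glued.
    congr triple; apply/ffunP=> m; rewrite !ffunE mem_res E0.
    by rewrite (cH None (Some m)).
  - case/negP: Nv; have := conn_copy1 G (T := T) (x := None) (y := x); rewrite E0.
    move/(_ (cH _ _)) => c; apply: conn_trans c _.
    by rewrite (conn_sym (gsK G')).
  - by rewrite E0 (cH None (Some m)) in Nm.
  constructor 1; exists (indicator (gres G T (Some u))); first by exists T, (Some u).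
  by rewrite vE stack_res_rest // indicator_rest.
have EK : #|horizontal T| = #|K|.-1.
  rewrite -TK -(vertical_horizontal DT) cardsU1 none_some card_imset ?horizontal_vertical //.
  exact: Some_inj.
have [E|x vx|m|u vE Nu] := stack_labelP T v; rewrite ?DT //=.
- case/negP: Nv; rewrite stack_connE E /= DT base_label0 //.
- move=> Nx; constructor 2; exists (indicator (gres H (horizontal T) x)).
    by exists (horizontal T), x.
  by rewrite (res_eq (gsK G') vx) stack_res_prism // indicator_prism.
constructor 1; exists (indicator (gres G T (Some u))); first by exists T, (Some u).
by rewrite vE stack_res_rest // indicator_rest.
Qed.

Lemma stack_codeP a0 w : a0 \in [set: K] ->
  cell_code G' #|K| w <->
  exists c g b, [/\ cell_code H #|K|.-1 c, cell_code G #|K| g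
                  & w = triple c (c + cst b) (g + cst b)].
Proof.
move=> aK; split.
  move: w; apply: span_ind_add.
  - by exists 0, 0, 0; rewrite cst0 !addr0 triple0; split=> //; apply: span0.
  - move=> _ _ [c [g [b [Cc Cg ->]]]] [c' [g' [b' [Cc' Cg' ->]]]].
    exists (c + c'), (g + g'), (b + b'); split; try exact: span_add.
    rewrite tripleD addrACA [g + _ + _]addrACA.
    by congr (triple _ (_ + _) (_ + _)); apply/ffunP=> u; rewrite !ffunE.
  move=> w /cell_word_stack[[g Cg ->]|[c Cc ->]|[T TK ->]].
  - by exists 0, g, 0; rewrite cst0 !addr0; split=> //; [apply: span0 | apply: span_gen].
  - by exists c, 0, 0; rewrite cst0 !addr0; split=> //; [apply: span_gen | apply: span0].
  (* On [G] the glued cell is the complement of a sum of cells of [G], hence it contributes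
     [b = 1]. *)
  - exists 0, (cst 1 + indicator (gres G T None)), 1; split; first exact: span0.
      by rewrite -TK; apply: cell_code_base.
    by rewrite add0r addrAC word_add add0r.
case=> c [g [b [Cc Cg ->]]].
have prism : cell_code G' #|K| (triple c c 0).
  have K0 : (0 < #|K|)%N by rewrite -cardsT; apply/card_gt0P; exists a0.
  elim: Cc => [|x y Cx _ IH]; first by rewrite triple0; apply: span0.
  rewrite -[0]addr0 -tripleD; apply: spanD IH.
  by rewrite -(prednK K0); apply: cell_word_prism.
have old h : cell_code G #|K| h -> cell_code G' #|K| (triple 0 0 h).
  elim=> [|x y Cx _ IH]; first by rewrite triple0; apply: span0.
  by rewrite -{1 2}[0]addr0 -tripleD; apply: spanD IH; apply: cell_word_old.
(* Adding the cells of [G] that make up the complement of its base cell completes the glued cell to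
   (0, 1, 1). *)
have glue : cell_code G' #|K| (triple 0 (cst 1) (cst 1)).
  set T := Some @: [set: K].
  have TK : #|T| = #|K| by rewrite card_imset ?cardsT //; apply: Some_inj.
  have := cell_code_base G T; rewrite TK => /old h.
  have := cell_word_glued aK; rewrite cardsT => /span_gen h'.
  have := span_add h h'; rewrite tripleD !add0r.
  have -> : indicator (gres H [set: K] None) = cst 1.
    by apply/ffunP=> m; rewrite !ffunE mem_res (cH None (Some m)).
  by rewrite -addrA word_add addr0.
have := span_add prism (old _ Cg); rewrite tripleD add0r !addr0.
case: (F2P b) => ->; first by rewrite cst0 !addr0.
by move/span_add/(_ glue); rewrite tripleD addr0.
Qed.

End StackCode.

(** * Parity and orthogonality of cells *)

Lemma weight_indicator (U : finType) (A : {set option U}) :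
  weight (indicator A) = #|A :\ None|.
Proof.
rewrite (_ : A :\ None = Some @: [set u | Some u \in A]).
  rewrite card_imset; last exact: Some_inj.
  by apply: eq_card => u; rewrite !inE ffunE; case: (_ \in _).
apply/setP=> -[u|]; first by rewrite !inE mem_imset ?inE //; apply: Some_inj.
by rewrite !inE eqxx; apply/esym/imsetP=> -[].
Qed.

Lemma dot_indicator (U : finType) (A B : {set option U}) :
  dot (indicator A) (indicator B) = (weight (indicator (A :&: B)))%:R.
Proof.
rewrite weightE natr_sum; apply: eq_bigr => u _; rewrite !ffunE inE.
by case: (_ \in A); case: (_ \in B); rewrite ?mul0r ?mulr0 ?mulr1 ?eqxx ?oner_eq0.
Qed.

Section CellOrthogonality.
Variables (K : finType) (G : gem K).
Implicit Types S T : {set K}.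

(** The common colour [a] pairs off the intersection; the first cell avoids the base point, so
    puncturing takes nothing from it. *)
Lemma dot_residues T S x y a : a \in T -> a \in S -> ~~ gconn G T None x ->
  dot (indicator (gres G T x)) (indicator (gres G S y)) = 0.
Proof.
move=> aT aS Nx; rewrite dot_indicator weight_indicator; apply/eqP; rewrite F2_natr_eq0.
have N0 : None \notin gres G T x :&: gres G S y.
  by rewrite inE mem_base_res (negPf Nx).
rewrite (_ : _ :\ None = gres G T x :&: gres G S y); last first.
  by apply/setDidPl; rewrite disjoint_sym disjoints1.
apply: (even_closed (gsK G) (gsN G) (a := a)) => z; rewrite !in_setI => /andP[zT zS].
by rewrite (res_closed aT zT) (res_closed aS zS).
Qed.

(** The residue is even and puncturing takes one vertex away. *)
Lemma odd_weight_base S a : a \in S -> odd (weight (indicator (gres G S None))).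
Proof.
move=> aS; rewrite weight_indicator.
have := even_closed (gsK G) (gsN G) (a := a) (A := gres G S None).
rewrite (card_base_del G S) /= negbK; apply=> z; exact: res_closed.
Qed.

(** The bound forces a common colour. With four colours it applies to 3-cells against 2-cells and
    against 3-cells. *)
Lemma cell_code_dot m S y w : (#|K| < m + #|S|)%N -> cell_code G m w ->
  dot w (indicator (gres G S y)) = 0.
Proof.
move=> mS; apply: span_dot => _ [T [x [Tm Nx ->]]].
have /card_gt0P[a] : (0 < #|T :&: S|)%N.
  by rewrite lt0n; apply: contraTneq mS => E; rewrite -leqNgt -Tm -cardsUI E addn0 max_card.
by rewrite inE => /andP[aT aS]; apply: (dot_residues _ aT aS Nx).
Qed.

Definition even_code e : Prop := forall w, cell_code G #|K|.-1 w -> (e %| weight w)%N.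

(** These are the words of the dual of C2 outside the dual of C1, once C1 is known to be C2 plus the
    all-ones word: oddness is non-orthogonality to that word. *)
Definition logical z : Prop := (forall c, cell_code G #|K|.-1 c -> dot c z = 0) /\ odd (weight z).

(** The property behind one encoded qubit: only X-stabilizers and their complements are orthogonal
    to all 2-cells. *)
Definition complete_code : Prop := forall x, (forall f, cell_word G 2 f -> dot x f = 0) ->
  exists e, cell_code G #|K|.-1 (x + cst e).

End CellOrthogonality.
Arguments even_code {K} G e.
Arguments logical {K} G z.
Arguments complete_code {K} G.

(** * Evenness, distance and completeness of a stack *)

Section StackDistance.
Variables (K : finType) (H : gem K) (G : gem (option K)) (a0 : K).
Notation M := (gpt H).
Notation U := (gpt G).
Notation G' := (stack H G).
Hypothesis cH : connected (@gs _ H).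

Let K' : #|{: option K}|.-1 = #|K|. Proof. by rewrite card_option. Qed.

Let codeP w : cell_code G' #|{: option K}|.-1 w <->
  exists c g b, [/\ cell_code H #|K|.-1 c, cell_code G #|{: option K}|.-1 g
                  & w = triple c (c + cst b) (g + cst b)].
Proof. by rewrite K'; exact: (@stack_codeP _ _ _ cH a0 w (in_setT a0)). Qed.

(** The weight of [(c, c, g)] is [2 * weight c + weight g], and that of [(c, c + 1, g + 1)] is
    [#|M| + #|U| - weight g], whence the third hypothesis. *)
Lemma stack_even e : even_code H e -> even_code G (2 * e) -> (2 * e %| #|M| + #|U|)%N ->
  even_code G' (2 * e).
Proof.
move=> eH eG eMU w /codeP[c [g [b [Cc Cg ->]]]]; rewrite weight_triple.
have := eG _ Cg; have /dvdnP[k Ek] := eH _ Cc.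
case: (F2P b) => ->.
  by rewrite cst0 !addr0 addnn -mul2n Ek => eg; rewrite dvdn_add // mulnCA dvdn_mull.
move=> eg; rewrite -(dvdn_addl _ eg) -addnA [(weight (g + _)%R + _)%N]addnC.
by rewrite [(weight g + _)%N]weightC weightC.
Qed.

Lemma stack_distance d d' :
    (forall z, logical H z -> (d <= weight z)%N) ->
    (forall z, logical G z -> (d' <= weight z)%N) -> (d <= d' + 2)%N ->
  forall z, logical G' z -> (d <= weight z)%N.
Proof.
move=> dH dG dd' z; have [x [y [t ->]]] := tripleP z.
move=> [zC]; rewrite weight_triple => oz.
have Hxy c : cell_code H #|K|.-1 c -> dot c (x + y) = 0.
  move=> Cc; have : cell_code G' #|{: option K}|.-1 (triple c c 0).
    by apply/codeP; exists c, 0, 0; rewrite cst0 !addr0; split=> //; apply: span0.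
  by move/zC; rewrite dot_triple dot0l addr0 -dotDr.
have Gt g : cell_code G #|{: option K}|.-1 g -> dot g t = 0.
  move=> Cg; have : cell_code G' #|{: option K}|.-1 (triple 0 0 g).
    by apply/codeP; exists 0, g, 0; rewrite cst0 !addr0; split=> //; apply: span0.
  by move/zC; rewrite dot_triple !dot0l !add0r.
(* Orthogonality to (0, 1, 1) ties the parities of the second and third parts. *)
have yt : odd (weight y) = odd (weight t).
  have : cell_code G' #|{: option K}|.-1 (triple 0 (cst 1) (cst 1)).
    by apply/codeP; exists 0, 0, 1; rewrite !add0r; split=> //; apply: span0.
  move/zC; rewrite dot_triple dot0l add0r !(dotC (cst 1)) !dot_weight -natrD => /eqP.
  by rewrite F2_natr_eq0 oddD; case: (odd _); case: (odd _).
case oxy: (odd (weight (x + y))).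
  by have := dH _ (conj Hxy oxy); have := weight_add x y; lia.
(* Here [x], [y] and [t] all turn out odd, so [x] and [y] bring at least one each: the 2 in
   [d' + 2]. *)
move: oxy; rewrite odd_weight_add => oxy.
have ot : odd (weight t) by move: oz; rewrite !oddD oxy.
have := dG _ (conj Gt ot); rewrite ot in yt; move: oxy; rewrite yt addbT => /negbFE ox.
by move: (odd_gt0 ox) (odd_gt0 yt); lia.
Qed.

(** The same point taken in both copies has product [b] with [(c, c + b)], and this cancels against
    the product of the odd word [z] with the constant [b]. *)
Lemma stack_min_logical d : (exists2 z, logical G z & weight z = d) ->
  exists2 z, logical G' z & weight z = (d + 2)%N.
Proof.
case=> z [zC oz] zd; have [m _] := gs_base H a0.
pose e : word M := [ffun m' => (m' == m)%:R].
have we : weight e = 1%N.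
  rewrite weightE (bigD1 m) //= ffunE eqxx big1 // => m' ne; by rewrite ffunE (negPf ne).
exists (triple e e z); last by rewrite weight_triple we zd addnC.
split; last by rewrite weight_triple we oddD oz.
move=> _ /codeP[c [g [b [Cc Cg ->]]]].
rewrite dot_triple !dotDl (zC _ Cg) add0r addrA F2_add add0r.
by rewrite !(dotC (cst b)) !dot_cst we (F2_natr (weight z)) oz F2_add.
Qed.

(** Completeness of the pieces gives constants [e] for [x] and [e'] for [z], and vertical squares
    make [x + y] a constant [b]. There remains [e' = e + b]. With two horizontal colours a
    two-coloured glued cell forces it; in the other case the all-ones word is a stabilizer of [H]
    and [e] can be shifted. *)
Lemma stack_complete : complete_code H -> complete_code G ->
    (2 <= #|K|)%N \/ cell_code H #|K|.-1 (cst 1) ->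
  complete_code G'.
Proof.
move=> kH kG alt w; have [x [y [z ->]]] := tripleP w => wC.
have xH f : cell_word H 2 f -> dot x f = 0.
  by move/(cell_word_copy1 G)/wC; rewrite dot_triple !dot0r !addr0.
have zG f : cell_word G 2 f -> dot z f = 0.
  by move/(cell_word_old H)/wC; rewrite dot_triple !dot0r !add0r.
(* The prism over an edge avoiding the base point is a Z-stabilizer, so [x + y] agrees at the two
   ends. *)
have edge a m m' : gs a (Some m) = Some m' -> (x + y) m = (x + y) m'.
  move=> E; have mm' : m' != m.
    by have := gsN H a (Some m); rewrite E.
  have : cell_word H 1 (indicator (gres H [set a] (Some m))).
    exists [set a], (Some m); rewrite cards1; split=> //.
    by rewrite -mem_base_res (res1 (gsK H)) !inE E.
  have indE u : indicator (gres H [set a] (Some m)) u = ((u == m) || (u == m'))%:R.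
    by rewrite ffunE (res1 (gsK H)) !inE E !(inj_eq Some_inj).
  move/(cell_word_prism G)/wC; rewrite dot_triple dot0r addr0 -dotDl /dot (bigD1 m) //=.
  rewrite (bigD1 m') //= big1 => [|u /andP[um um']]; last first.
    by rewrite indE (negPf um) (negPf um') mulr0.
  rewrite addr0 !indE !eqxx orbT !mulr1 => /eqP.
  rewrite addr_eq0 => /eqP ->; apply/eqP; rewrite eq_sym -addr_eq0; exact/eqP/F2_add.
have [m0 Em0] := gs_base H a0; set b := (x + y) m0.
(* Edges at the base point of [H] give no such equation; its neighbours are compared through
   [neighbors_linked]. *)
have neigh a m : gs a None = Some m -> (x + y) m = b.
  move=> Em; have := @neighbors_linked _ H
    (fun v => if v is Some m then (x + y) m == b else true) a0 a.
  rewrite Em Em0 /= eqxx => /(_ _ isT)/eqP; apply.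
  by move=> c [m1|] // _ _; case E: (gs c (Some m1)) => [m2|] // _; rewrite (edge _ _ _ E).
have xyb m : (x + y) m = b.
  apply: (conn_ind (P := fun v => if v is Some m then (x + y) m = b else True) _ _ (cH None (Some m))) => //.
  move=> [m1|] a _; case E: (gs a _) => [m2|] //; first by rewrite (edge _ _ _ E).
  by move=> _; apply: neigh E.
have yE : y = x + cst b.
  apply/ffunP=> m; rewrite -[b](xyb m) !ffunE.
  by rewrite addrA F2_add add0r.
have [e Ce] := kH _ xH; have [e' Ce'] := kG _ zG.
have finish e1 : cell_code H #|K|.-1 (x + cst e1) -> e' = e1 + b ->
    cell_code G' #|{: option K}|.-1 (triple x y z + cst e1).
  move=> Ce1 Ee'; apply/codeP; exists (x + cst e1), (z + cst e'), b; split=> //.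
  rewrite -triple_cst tripleD yE addrAC Ee'; congr triple.
  by apply/ffunP=> u; rewrite !ffunE -!addrA F2_add addr0.
have [Ee|ne] := eqVneq e' (e + b); first by exists e; apply: finish.
have {}ne : e' = e + 1 + b.
  by move: ne; case: (F2P e) => ->; case: (F2P e') => ->; case: (F2P b) => ->;
    rewrite // => _; apply: val_inj.
case: alt => [K2|C1]; last first.
  exists (e + 1); apply: finish => //.
  rewrite (_ : cst (e + 1) = cst e + cst 1); last by apply/ffunP=> u; rewrite !ffunE.
  by rewrite addrA; apply: span_add.
have [a1 a1N] : exists a1, a1 != a0.
  have := cardsC1 a0; move: K2; rewrite -[#|K|]cardsT cardsT => K2 EC.
  have /card_gt0P[a1] : (0 < #|[set~ a0]|)%N by rewrite EC; move: K2; case: #|K| => [|[]].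
  by rewrite !inE => a1N; exists a1.
set S := [set a0; a1]; have S2 : #|S| = 2 by rewrite cards2 eq_sym a1N.
have aS : a0 \in S by rewrite set21.
have aS' : Some a0 \in Some @: S by rewrite imset_f.
have S2' : #|Some @: S| = 2 by rewrite card_imset //; apply: Some_inj.
(* The two-coloured glued cell has odd weight in both parts and is orthogonal to both cell codes, so
   its equation reduces to [(e + b) + e' = 0]. *)
have := cell_word_glued H G aS; rewrite S2 => /wC; rewrite dot_triple dot0r add0r.
have -> : y = (x + cst e) + cst (e + b).
  rewrite yE -addrA; congr (_ + _); apply/ffunP=> u; rewrite !ffunE.
  by rewrite addrA F2_add add0r.
rewrite (_ : z = z + cst e' + cst e'); last by rewrite -addrA word_add addr0.
rewrite (dotDl (x + cst e)) (dotDl (z + cst e')) (cell_code_dot _ _ Ce); last by rewrite S2; move: K2; lia.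
rewrite (cell_code_dot _ _ Ce') ?add0r; last by rewrite S2' card_option; lia.
rewrite (dotC (cst _)) dot_cst (dotC (cst _)) dot_cst.
rewrite [X in _ * X + _]F2_natr [X in _ + _ * X]F2_natr.
rewrite (odd_weight_base _ aS) (odd_weight_base _ aS') !mulr1 ne.
by case: (F2P e) => ->; case: (F2P b) => -> => /(congr1 val).
Qed.

End StackDistance.

(** * The family of lattices *)

Section TwoVertices.
Variable K : finType.

(** Two vertices joined by one edge of each colour: the sphere at the start of every tower.
    Punctured, it has a single qubit. *)
Definition swap_vertices (a : K) (x : option unit) : option unit :=
  if x is None then Some tt else None.

Fact swap_verticesK a : involutive (swap_vertices a).
Proof. by case=> [[]|]. Qed.

Fact swap_verticesN a x : swap_vertices a x != x.
Proof. by case: x => [[]|]. Qed.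

Definition two_vertices : gem K := Gem swap_verticesK swap_verticesN.

Lemma two_vertices_conn (T : {set K}) a x y : a \in T -> gconn two_vertices T x y.
Proof.
move=> aT; case: (eqVneq y x) => [->|ne]; first exact: conn_refl.
suff -> : y = gs (g := two_vertices) a x by apply: conn_step.
by case: x y ne => [[]|] [[]|].
Qed.

Lemma two_vertices_res (T : {set K}) a x : a \in T -> gres two_vertices T x = setT.
Proof. by move=> aT; apply/setP=> y; rewrite mem_res (two_vertices_conn _ _ aT) inE. Qed.

Lemma two_vertices_spherical : spherical3 (@gs _ two_vertices).
Proof.
move=> a b c x _ _ _ /=.
have one (S : {set K}) d : d \in S -> ncomp (@gs _ two_vertices) S setT = 1%N.
  move=> dS; rewrite -(@two_vertices_res S d None dS).
  by rewrite (ncomp_le1 (gsK two_vertices)).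
rewrite (@two_vertices_res _ a) ?inE ?eqxx //.
rewrite (one _ a) ?inE ?eqxx // (one _ b) ?inE ?eqxx // (one _ a) ?inE ?eqxx //.
by rewrite cardsT card_option card_unit.
Qed.

Lemma two_vertices_cell_code m w : (0 < m)%N -> cell_code two_vertices m w -> w = 0.
Proof.
move=> m0; elim=> // x y [T [z [Tm Nz _]]] _ _.
have /card_gt0P[a aT] : (0 < #|T|)%N by rewrite Tm.
by rewrite (two_vertices_conn _ _ aT) in Nz.
Qed.

Lemma two_vertices_complete : complete_code two_vertices.
Proof.
move=> x _; exists (x tt); rewrite (_ : _ + _ = 0); first exact: span0.
by apply/ffunP=> -[]; rewrite !ffunE F2_add.
Qed.

End TwoVertices.

Fixpoint colors (D : nat) : finType :=
  if D is D'.+1 then option (colors D') : finType else unit : finType.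

(** The recursion is lexicographic in dimension and distance. In dimension 0 the code consists of
    all words and has no logical word, so one graph satisfies every distance bound. *)
Fixpoint tower (D : nat) : nat -> gem (colors D) :=
  match D with
  | 0 => fun=> two_vertices unit
  | D'.+1 => fix towerD t :=
      if t is t'.+1 then stack (tower D' t) (towerD t') else two_vertices (option (colors D'))
  end.

Lemma towerS D t : tower D.+1 t.+1 = stack (tower D t.+1) (tower D.+1 t).
Proof. by []. Qed.

Lemma tower0 D : tower D 0 = two_vertices (colors D).
Proof. by case: D. Qed.

Lemma tower_ind (P : forall D, nat -> gem (colors D) -> Prop) :
    (forall t, P 0 t (two_vertices (colors 0))) ->
    (forall D, P D.+1 0 (two_vertices (colors D.+1))) ->
    (forall D t, P D t.+1 (tower D t.+1) -> P D.+1 t (tower D.+1 t) ->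
       P D.+1 t.+1 (stack (tower D t.+1) (tower D.+1 t))) ->
  forall D t, P D t (tower D t).
Proof.
move=> P0 P1 PS; elim=> [|D IHD] t; first exact: P0.
by elim: t => [|t IHt]; [apply: P1 | rewrite towerS; apply: PS].
Qed.

Lemma card_colors D : #|colors D| = D.+1.
Proof. by elim: D => [|D IH]; rewrite ?card_unit // [LHS]card_option IH. Qed.

Fixpoint color0 D : colors D := if D is D'.+1 then None else tt.

Lemma tower_connected D t : connected (@gs _ (tower D t)).
Proof.
move: D t; apply: (tower_ind (P := fun D t g => connected (@gs _ g))).
- by move=> t x y; apply: (@two_vertices_conn (colors 0) _ (color0 0)).
- by move=> D x y; apply: (@two_vertices_conn (colors D.+1) _ (color0 D.+1)).
- by move=> D t; apply: stack_connected.
Qed.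

Lemma tower_spherical D t : spherical3 (@gs _ (tower D t)).
Proof.
move: D t; apply: (tower_ind (P := fun D t g => spherical3 (@gs _ g))).
- by move=> t; apply: two_vertices_spherical.
- by move=> D; apply: two_vertices_spherical.
- by move=> D t; apply: stack_spherical.
Qed.

Lemma tower_distance D t z : logical (tower D t) z -> (2 * t + 1 <= weight z)%N.
Proof.
move: D t z; apply: (tower_ind (P := fun D t g =>
  forall z, logical g z -> (2 * t + 1 <= weight z)%N)).
(* In dimension 0 the only qubit is itself an X-stabilizer, which no odd word commutes with. *)
- move=> t z [zC]; suff -> : z = 0 by rewrite weight0.
  apply/ffunP=> -[]; rewrite ffunE.
  have : cell_code (two_vertices (colors 0)) #|colors 0|.-1 (cst 1).
    rewrite card_colors /=; apply: span_gen; exists set0, (Some tt).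
    rewrite cards0 -mem_base_res res0 inE; split=> //.
    by apply/ffunP=> -[]; rewrite !ffunE inE.
  move/zC; rewrite /dot (bigD1 tt) //= big1 ?addr0; last by case.
  by rewrite ffunE mul1r.
- by move=> D z [_ oz]; rewrite muln0 odd_gt0.
- move=> D t IH1 IH2; apply: (stack_distance (color0 D) (@tower_connected D t.+1) IH1 IH2).
  lia.
Qed.

Lemma tower_min_logical D t : exists2 z, logical (tower D.+1 t) z & weight z = (2 * t + 1)%N.
Proof.
elim: t => [|t IH].
  exists (cst 1); last by rewrite weight_cst1 card_unit.
  split; last by rewrite weight_cst1 card_unit.
  move=> c /two_vertices_cell_code -> //; first by rewrite dot0l.
  by rewrite card_colors.
rewrite towerS (_ : 2 * t.+1 + 1 = 2 * t + 1 + 2)%N; last by lia.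
exact: (stack_min_logical (color0 D) (@tower_connected D t.+1) IH).
Qed.

Lemma tower_complete D t : complete_code (tower D t).
Proof.
move: D t; apply: (tower_ind (P := fun D t g => complete_code g)).
- by move=> t; apply: two_vertices_complete.
- by move=> D; apply: two_vertices_complete.
move=> D t IH1 IH2; apply: (stack_complete (color0 D)) => //; first exact: tower_connected.
(* Over dimension 0 there is a single horizontal colour; there the all-ones word is the one
   remaining vertex, a stabilizer. *)
case: D IH1 IH2 => [|D] _ _; last by left; rewrite card_colors.
right; rewrite card_colors /=; apply: span_gen; exists set0, (Some tt).
rewrite cards0 -mem_base_res res0 inE; split=> //.
by apply/ffunP=> -[]; rewrite !ffunE inE.
Qed.

(** * Sizes and triple evenness of the towers *)

Definition tower_size D t : nat := #|gpt (tower D t)|.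

Lemma tower_sizeS D t :
  tower_size D.+1 t.+1 = (2 * tower_size D t.+1 + tower_size D.+1 t)%N.
Proof. by rewrite /tower_size towerS [LHS]card_sum card_sum addnn mul2n. Qed.

Lemma tower_size0 D : tower_size D 0 = 1%N.
Proof. by rewrite /tower_size tower0 card_unit. Qed.

Lemma tower_size_0 t : tower_size 0 t = 1%N.
Proof. exact: card_unit. Qed.

Lemma tower_size_1 t : tower_size 1 t = (2 * t + 1)%N.
Proof. by elim: t => [|t IH]; rewrite ?tower_size0 // tower_sizeS IH tower_size_0; lia. Qed.

Lemma tower_size_2 t : tower_size 2 t = (2 * t ^ 2 + 4 * t + 1)%N.
Proof. by elim: t => [|t IH]; rewrite ?tower_size0 // tower_sizeS IH tower_size_1; lia. Qed.

(** With [k = t + 1] this is the announced length, multiplied by 3 and free of subtraction to stay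
    in the naturals. *)
Lemma tower_size_3 t :
  (3 * tower_size 3 t + 3 * (2 * t + 3) = 2 * (t + 1) * (t + 2) * (2 * t + 3))%N.
Proof.
elim: t => [|t IH]; rewrite ?tower_size0 // tower_sizeS tower_size_2.
move: IH; set n := tower_size 3 t; nia.
Qed.

Lemma tower_evenS D e : (forall t, even_code (tower D t) e) ->
    (forall t, 2 * e %| tower_size D t.+1 + tower_size D.+1 t)%N ->
  forall t, even_code (tower D.+1 t) (2 * e).
Proof.
move=> eD de; elim=> [|t IH].
  by move=> w /two_vertices_cell_code ->; rewrite ?card_colors // weight0 dvdn0.
by rewrite towerS; apply: (stack_even (color0 D) (@tower_connected D t.+1) (eD _) IH (de t)).
Qed.

Lemma tower_even t : even_code (tower 3 t) 8.
Proof.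
have e0 t' : even_code (tower 0 t') 1 by move=> w _; apply: dvd1n.
have e1 t' : even_code (tower 1 t') 2.
  apply: (tower_evenS (e := 1) e0) => {}t'; rewrite tower_size_0 tower_size_1; lia.
have e2 t' : even_code (tower 2 t') 4.
  apply: (tower_evenS (e := 2) e1) => {}t'; rewrite tower_size_1 tower_size_2.
  rewrite (_ : _ + _ = 2 * ((t' + 1) * (t' + 2)))%N; last by nia.
  by rewrite dvdn_pmul2l // dvdn2 oddM !oddD; case: (odd t').
apply: (tower_evenS (e := 4) e2) => {}t.
(* [tower_size_3] gives three times the size; the tripled sum is [4 (t + 1) (t + 2) (t + 3)], and 3
   is prime to 8. *)
rewrite -(@Gauss_dvdr _ 3) // tower_size_2.
have := tower_size_3 t; set n := tower_size 3 t => E.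
rewrite (_ : 3 * _ = 4 * ((t + 1) * (t + 2)) * (t + 3))%N; last by move: E; nia.
apply: dvdn_mulr; rewrite (mulnC 2) dvdn_pmul2l //.
by rewrite dvdn2 oddM !oddD; case: (odd t).
Qed.

(** * The CSS code of a lattice *)

Lemma dotpC n (x y : 'rV['F_2]_n) : dotp x y = dotp y x.
Proof. by apply: eq_bigr => i _; rewrite mulrC. Qed.

(** The columns of a cokernel matrix of a basis of [C] lie in the dual, and a word orthogonal to all
    of them is in the row space. *)
Lemma dual_dual n (C : {vspace 'rV['F_2]_n}) : dual (dual C) = C.
Proof.
apply/eqP; rewrite eqEsubv; apply/andP; split; apply/subvP=> x; last first.
  by move=> xC; apply/mem_dualP=> c /mem_dualP/(_ _ xC); rewrite dotpC.
move/mem_dualP=> xD.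
pose A : 'M['F_2]_(\dim C, n) := \matrix_i (vbasis C)`_i.
have inC y : (y <= A)%MS -> y \in C.
  case/submxP=> D ->; rewrite mulmx_sum_row; apply: memv_suml => i _.
  by apply: memvZ; rewrite rowK vbasis_mem // mem_nth // size_tuple.
apply: inC; rewrite submxE; apply/eqP/matrixP=> i j; rewrite !mxE (ord1 i).
have kerD : \row_l cokermx A l j \in dual C.
  apply/mem_dualP=> c /coord_vbasis ->; rewrite dotpC linear_sum big1 // => k _.
  rewrite linearZ /= (_ : dotp _ _ = 0) ?scaler0 //.
  have := congr1 (fun B : 'M_(_, _) => B k j) (mulmx_coker A); rewrite !mxE => <-.
  by rewrite dotpC; apply: eq_bigr => l _; rewrite !mxE.
apply: etrans (xD _ kerD); rewrite dotpC; apply: eq_bigr => l _; congr (_ * _).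
by rewrite [RHS]mxE.
Qed.

Section LatticeCode.
Variables (K : finType) (G : gem K).
Hypothesis cardK : #|K| = 4%N.
Notation U := (gpt G).
Notation cell := (rcell (@gs _ G)).
Notation dim := (@cdim _ _ (@gs _ G)).

Fact set0_neqT : set0 != setT :> {set K}.
Proof. by rewrite eq_sym -card_gt0 cardsT cardK. Qed.

Definition vertex_cell (x : option U) : cell := mkcell (@gs _ G) set0_neqT x.

Notation p := (vertex_cell None).
Notation N := (num_qubits dim p).

Lemma dim_vertex x : dim (vertex_cell x) = 0.
Proof. by rewrite /cdim /= cards0. Qed.

Lemma mem_vertex x : x \in cset (vertex_cell x).
Proof. exact: mem_mkcell. Qed.

Lemma vertex_le x c : (vertex_cell x <= c)%O = (x \in cset c).
Proof. by rewrite (le_at (gsK G) _ (mem_vertex x)) sub0set. Qed.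

Lemma vertex_cellP c : dim c = 0 -> exists x, c = vertex_cell x.
Proof.
move=> c0; have [x xc] := rcell_ex c; exists x.
apply: (rcell_inj_at (gsK G) xc (mem_vertex x)).
by apply/eqP; rewrite -cards_eq0 -[#|_|]/(dim c) c0.
Qed.

Lemma vertex_inj : injective vertex_cell.
Proof.
move=> x y e; have := mem_vertex x; rewrite e -vertex_le (le_at (gsK G) _ (mem_vertex x)).
by rewrite /cset /= res0 inE => /andP[_ /eqP].
Qed.

Lemma qubit_ex (i : 'I_N) : exists u, enum_val i == vertex_cell (Some u).
Proof.
have := enum_valP i; rewrite !inE => /andP[/eqP/vertex_cellP[[u|] ->]].
  by exists u.
by rewrite lexx.
Qed.

Definition qubit_pt (i : 'I_N) : U := xchoose (qubit_ex i).

Lemma qubit_ptE i : enum_val i = vertex_cell (Some (qubit_pt i)).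
Proof. exact/eqP/(xchooseP (qubit_ex i)). Qed.

Lemma qubit_pt_inj : injective qubit_pt.
Proof. by move=> i j e; apply: enum_val_inj; rewrite !qubit_ptE e. Qed.

Lemma num_qubitsE : N = #|U|.
Proof.
rewrite /num_qubits -(card_imset _ (inj_comp vertex_inj (@Some_inj _))).
apply: eq_card => c; rewrite !inE vertex_le; apply/andP/imsetP => [[/eqP]|[u _ ->]].
  case/vertex_cellP=> -[u|] ->; first by exists u.
  by rewrite mem_vertex.
rewrite dim_vertex eqxx; split=> //; rewrite /cset /= res0 inE //.
Qed.

Lemma qubit_pt_bij : bijective qubit_pt.
Proof. by apply: inj_card_bij qubit_pt_inj _; rewrite card_ord num_qubitsE. Qed.

Definition to_row (w : word U) : 'rV['F_2]_N := \row_i w (qubit_pt i).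

Definition of_row (x : 'rV['F_2]_N) : word U :=
  [ffun u => \sum_(i | qubit_pt i == u) x 0 i].

Lemma of_rowE x i : of_row x (qubit_pt i) = x 0 i.
Proof.
rewrite ffunE (big_pred1 i) // => j /=.
by apply/eqP/eqP => [/qubit_pt_inj|->].
Qed.

Lemma of_rowK : cancel of_row to_row.
Proof. by move=> x; apply/rowP=> i; rewrite mxE of_rowE. Qed.

Lemma to_rowK : cancel to_row of_row.
Proof.
move=> w; apply/ffunP=> u; have [inv _ invK] := qubit_pt_bij.
by rewrite -[u]invK of_rowE mxE.
Qed.

Lemma to_rowD x y : to_row (x + y) = to_row x + to_row y.
Proof. by apply/rowP=> i; rewrite !mxE ffunE. Qed.

Lemma to_row0 : to_row 0 = 0.
Proof. by apply/rowP=> i; rewrite !mxE ffunE. Qed.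

Lemma of_rowD x y : of_row (x + y) = of_row x + of_row y.
Proof. by apply: (can_inj to_rowK); rewrite to_rowD !of_rowK. Qed.

Lemma of_row0 : of_row 0 = 0.
Proof. by apply: (can_inj to_rowK); rewrite of_rowK to_row0. Qed.

Lemma dotp_to_row x y : dotp (to_row x) (to_row y) = dot x y.
Proof.
rewrite /dotp /dot (reindex qubit_pt) /=; last exact/onW_bij/qubit_pt_bij.
by apply: eq_bigr => i _; rewrite !mxE.
Qed.

Lemma hweight_to_row x : hweight (to_row x) = weight x.
Proof.
rewrite weightE (reindex qubit_pt) /=; last exact/onW_bij/qubit_pt_bij.
rewrite /hweight -sum1dep_card big_mkcond; apply: eq_bigr => i _ /=.
by rewrite mxE; case: (_ != _).
Qed.

Lemma qubit_supportE c : qubit_support dim p c = to_row (indicator (cset c)).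
Proof. by apply/rowP=> i; rewrite !mxE ffunE qubit_ptE vertex_le. Qed.

Lemma punctured_cell_word m c : c \in punctured_cells dim p m ->
  cell_word G m (indicator (cset c)).
Proof.
rewrite !inE vertex_le => /andP[/eqP cm]; have [x xc] := rcell_ex c.
rewrite (cset_res (gsK G) xc) mem_base_res => Nx.
by exists (ctype c), x.
Qed.

Lemma mem_cell_space m w : (m < 4)%N ->
  to_row w \in cell_space dim p m <-> cell_code G m w.
Proof.
move=> m4; split; last first.
  elim=> [|x y [T [z [Tm Nz ->]]] _ IH]; first by rewrite to_row0 mem0v.
  rewrite to_rowD memvD //; apply/memv_span/imageP.
  have hT : T != setT.
    by apply: contraTneq m4 => TT; rewrite -Tm TT cardsT cardK.
  exists (mkcell (@gs _ G) hT z); last by rewrite qubit_supportE.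
  by rewrite !inE vertex_le mem_base_res Nz /cdim /= Tm eqxx.
rewrite -{2}[w]to_rowK; move: (to_row w) => x; pose X := [seq qubit_support dim p c | c in punctured_cells dim p m].
have -> : x \in cell_space dim p m = (x \in <<in_tuple X>>%VS) by [].
move/coord_span=> ->.
apply: (big_ind (fun x => cell_code G m (of_row x))) => [|y z Cy Cz|i _].
- by rewrite of_row0; apply: span0.
- by rewrite of_rowD; apply: span_add.
case: (F2P (coord (in_tuple X) i x)) => ->.
  by rewrite scale0r of_row0; apply: span0.
rewrite scale1r.
have /imageP[c cm ->] : (in_tuple X)`_i \in X by rewrite mem_nth.
by rewrite qubit_supportE to_rowK; apply/span_gen/punctured_cell_word.
Qed.

(** * Parameters and weights of the lattice code *)

Hypotheses (cG : connected (@gs _ G)) (sG : spherical3 (@gs _ G)).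
Hypotheses (evenG : even_code G 8) (completeG : complete_code G).
Variable d : nat.
Hypotheses (distG : forall z, logical G z -> (d <= weight z)%N)
  (minG : exists2 z, logical G z & weight z = d) (oddU : odd #|U|).

Notation C2 := (cell_space dim p 3).
Notation C1 := (dual (cell_space dim p 2)).

Let K3 : #|K|.-1 = 3. Proof. by rewrite cardK. Qed.

Lemma mem_C2 w : to_row w \in C2 <-> cell_code G #|K|.-1 w.
Proof. by rewrite K3; apply: mem_cell_space. Qed.

Lemma mem_C1 w : to_row w \in C1 <-> (forall f, cell_word G 2 f -> dot w f = 0).
Proof.
split=> [/mem_dualP wC f Cf|wC].
  by rewrite dotC -dotp_to_row; apply: wC; apply/mem_cell_space => //; apply: span_gen.
apply/mem_dualP=> c; rewrite -[c]of_rowK => /mem_cell_space -/(_ isT) Cc.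
rewrite dotp_to_row; apply: span_dot Cc => f Cf; rewrite dotC; exact: wC.
Qed.

Lemma cell_code_even w f : cell_code G #|K|.-1 w -> cell_code G 2 f -> dot w f = 0.
Proof.
move=> Cw Cf; rewrite dotC; apply: span_dot Cf => _ [T [x [Tm Nx ->]]].
by rewrite dotC; apply: (cell_code_dot _ _ Cw); rewrite K3 Tm cardK.
Qed.

Lemma cell_code_self w f : cell_code G #|K|.-1 w -> cell_code G #|K|.-1 f -> dot w f = 0.
Proof.
move=> Cw Cf; rewrite dotC; apply: span_dot Cf => _ [T [x [Tm Nx ->]]].
by rewrite dotC; apply: (cell_code_dot _ _ Cw); rewrite Tm cardK.
Qed.

Lemma weight_C2 w : cell_code G #|K|.-1 w -> ~~ odd (weight w).
Proof.
by move/evenG => h; rewrite -dvdn2; apply: dvdn_trans h.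
Qed.

(** One direction is completeness; for the other, 2-cells have even weight, so constants are
    orthogonal to them. Hence C1 is C2 plus the all-ones word. *)
Lemma C1P w : to_row w \in C1 <-> exists e, cell_code G #|K|.-1 (w + cst e).
Proof.
split; first by move/mem_C1/completeG.
case=> e Ce; apply/mem_C1 => f Cf.
rewrite (_ : w = w + cst e + cst e); last by rewrite -addrA word_add addr0.
rewrite dotDl (cell_code_even Ce) ?add0r; last exact: span_gen.
rewrite dotC dot_cst; case: Cf => T [x [T2 Nx ->]].
have /card_gt0P[a aT] : (0 < #|T|)%N by rewrite T2.
suff : ~~ odd (weight (indicator (gres G T x))).
  by rewrite -F2_natr_eq0 => /eqP ->; rewrite mulr0.
rewrite -F2_natr_eq0 -[X in indicator X]setIid -dot_indicator.
by rewrite (dot_residues _ aT aT Nx).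
Qed.

Fact lattice_code_sub : (C2 <= C1)%VS.
Proof.
apply/subvP=> x; rewrite -[x]of_rowK => /mem_C2 Cx; apply/C1P.
by exists 0; rewrite cst0 addr0.
Qed.

Definition lattice_code : css_code N := CSSCode lattice_code_sub.

Lemma lattice_code_dual : dual C1 = cell_space dim p 2.
Proof. exact: dual_dual. Qed.

Lemma mem_dual_C2 z : to_row z \in dual C2 <->
  (forall c, cell_code G #|K|.-1 c -> dot c z = 0).
Proof.
split=> [/mem_dualP zC c Cc|zC]; first by rewrite -dotp_to_row; apply: zC; apply/mem_C2.
by apply/mem_dualP=> c; rewrite -[c]of_rowK => /mem_C2 Cc; rewrite dotp_to_row; apply: zC.
Qed.

Lemma cst1_C1 : to_row (cst 1) \in C1.
Proof. by apply/C1P; exists 1; rewrite word_add; apply: span0. Qed.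

Lemma cst1_C2 : to_row (cst 1) \notin C2.
Proof. by apply/negP=> /mem_C2/weight_C2; rewrite weight_cst1 oddU. Qed.

Lemma logicalP z : logical G z <-> (to_row z \in dual C2) && (to_row z \notin dual C1).
Proof.
split=> [[zC oz]|/andP[/mem_dual_C2 zC nz]].
  apply/andP; split; first exact/mem_dual_C2.
  apply/negP=> /mem_dualP/(_ _ cst1_C1); rewrite dotp_to_row dotC dot_weight => /eqP.
  by rewrite F2_natr_eq0 oz.
split=> //; apply: contraR nz => ez; apply/mem_dualP=> c.
rewrite -[c]of_rowK => /C1P[e Ce]; rewrite dotp_to_row.
rewrite (_ : of_row c = of_row c + cst e + cst e); last by rewrite -addrA word_add addr0.
rewrite dotDl zC // add0r dotC dot_cst.
by move: ez; rewrite -F2_natr_eq0 => /eqP ->; rewrite mulr0.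
Qed.

(** 3-cells are orthogonal to one another, and on an odd number of qubits the complement of an even
    word is odd. This yields [d <= dx] from the bound on logical words. *)
Lemma C1_logical x : to_row x \in C1 -> to_row x \notin C2 -> logical G x.
Proof.
move=> /C1P[e Ce] nC; have e1 : e = 1.
  by case: (F2P e) Ce => -> //; rewrite cst0 addr0 => /mem_C2; rewrite (negPf nC).
rewrite e1 in Ce.
rewrite (_ : x = x + cst 1 + cst 1); last by rewrite -addrA word_add addr0.
split=> [c Cc|].
  rewrite dotDr (cell_code_self Cc Ce) add0r dot_weight; apply/eqP.
  by rewrite F2_natr_eq0 weight_C2.
by rewrite odd_weight_add weight_cst1 oddU (negPf (weight_C2 Ce)).
Qed.

Lemma dim_lattice_code : \dim C1 = (\dim C2 + 1)%N.
Proof.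
have -> : C1 = (C2 + <[to_row (cst 1)]>)%VS.
  apply/eqP; rewrite eqEsubv subv_add lattice_code_sub -memvE cst1_C1 /= andbT.
  apply/subvP=> x; rewrite -[x]of_rowK => /C1P[e Ce].
  rewrite (_ : of_row x = (of_row x + cst e) + cst e); last by rewrite -addrA word_add addr0.
  rewrite to_rowD memv_add //; first exact/mem_C2.
  case: (F2P e) => ->; first by rewrite cst0 to_row0 mem0v.
  exact: memv_line.
rewrite dimv_disjoint_sum; last first.
  apply/eqP; rewrite -subv0; apply/subvP=> x /memv_capP[xC /vlineP[a Ex]].
  move: xC; rewrite Ex memv0; case: (F2P a) => ->; rewrite ?scale0r ?eqxx // scale1r.
  by rewrite (negPf cst1_C2).
rewrite dim_vline; case: eqP => // E0.
by have := cst1_C2; rewrite E0 mem0v.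
Qed.

Lemma lattice_code_parameters : css_parameters lattice_code 1 d.
Proof.
split; first exact: dim_lattice_code.
pose P := [pred x : 'rV['F_2]_N | (x \in C1) && (x \notin C2)].
have P1 : P (to_row (cst 1)) by rewrite /= cst1_C1 cst1_C2.
(* [dx] is taken as an attained minimum whose value is not computed: [dz = d] and [d <= dx] settle
   the distance. *)
case: (arg_minnP (@hweight N) P1) => x Px xmin.
exists (hweight x), d; split.
- by split; first by exists x.
- split.
    have [z Lz <-] := minG; exists (to_row z); last exact: hweight_to_row.
    exact/logicalP.
  move=> z; rewrite -[z]of_rowK hweight_to_row => Sz; apply: distG.
  exact/logicalP.
apply/esym/minn_idPr; move: Px; rewrite -[x]of_rowK hweight_to_row => /andP[x1 x2].
exact/distG/C1_logical.
Qed.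

Lemma weight_lattice_code c : c \in C2 -> (8 %| hweight c)%N.
Proof.
by rewrite -[c]of_rowK hweight_to_row => /mem_C2; apply: evenG.
Qed.

(** A word of C1 outside C2 is the complement of a word of C2, whose weight is a multiple of 8. *)
Lemma weight_C1 x : x \in C1 ->
  if x \in C2 then (8 %| hweight x)%N else (hweight x == N %[mod 8])%N.
Proof.
case: ifP => [/weight_lattice_code //|].
rewrite -[x]of_rowK hweight_to_row => nC /C1P[e Ce].
case: (F2P e) Ce => ->; first by rewrite cst0 addr0 => /mem_C2; rewrite nC.
move/evenG; rewrite num_qubitsE -(weightC (of_row x)) => /dvdnP[k ->].
by rewrite addnC modnMDl.
Qed.

Lemma lattice_color_lattice : color_lattice dim.
Proof.
apply: residues_color_lattice => //; [exact: gsK | exact: gsN | | exact: None].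
exact: spherical3W.
Qed.

Definition lattice_color_code : color_code_3d :=
  @ColorCode3D residue_display cell dim p 3 2 lattice_color_lattice (dim_vertex None)
    isT isT isT lattice_code erefl lattice_code_dual.

End LatticeCode.

(** * The transversal gate *)

Section TransversalT.
Variable R : realType.
Notation zeta := (T_phase R).

Lemma T_phase8 : zeta ^+ 8 = 1.
Proof.
have z2 : zeta ^+ 2 = 'i%C.
  rewrite expr2 /T_phase; apply/eqP; rewrite eq_complex /=.
  have e : pi / 4 + pi / 4 = pi / 2 :> R by rewrite (splitr (pi / 2)) -mulrA -invfM -natrM.
  by rewrite -cosD [X in _ && (X == _)]addrC -sinD e cos_pihalf sin_pihalf !eqxx.
rewrite (exprM zeta 2 4) z2 (exprM _ 2 2) sqr_i.
by rewrite sqrrN expr1n.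
Qed.

Lemma T_phase_norm : zeta * zeta^* = 1.
Proof.
by rewrite -normCK normc_def /= cos2Dsin2 sqrtr1 expr1n.
Qed.

Lemma T_phase_mod8 m m' : (m = m' %[mod 8])%N -> zeta ^+ m = zeta ^+ m'.
Proof.
move=> e; rewrite (divn_eq m 8) (divn_eq m' 8) e !exprD.
by rewrite ![(_ * 8)%N]mulnC !exprM T_phase8 !expr1n.
Qed.

Definition phase_gate (q : R[i]) : 'M[R[i]]_2 :=
  diag_mx (\row_(i < 2) (if i == 0 then 1 else q)).

Lemma tensor_phase_gate n q (psi : state R n) y :
  tensor_gate (fun=> phase_gate q) psi y = q ^+ hweight y * psi y.
Proof.
rewrite ffunE (bigD1 y) //= [X in _ + X]big1 ?addr0 => [|x xy]; last first.
  have [i xi] : exists i, x 0 i != y 0 i.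
    apply/existsP; apply: contraR xy; rewrite negb_exists => /forallP h.
    by apply/eqP/rowP=> i; apply/eqP; have := h i; rewrite negbK.
  by rewrite (bigD1 i) //= !mxE (eq_sym (y 0 i) (x 0 i)) (negPf xi) mulr0n !mul0r.
congr (_ * _); rewrite /hweight -sum1dep_card [in RHS]big_mkcond -prodrXr.
apply: eq_bigr => i _; rewrite !mxE eqxx mulr1n.
by case: (F2P (y 0 i)) => ->.
Qed.

Lemma phase_gate_unitary q : q * q^* = 1 -> phase_gate q \is unitarymx.
Proof.
move=> qq; apply/unitarymxP.
rewrite /phase_gate tr_diag_mx map_diag_mx mulmx_diag -diag_const_mx; congr diag_mx.
by apply/rowP=> i; rewrite !mxE; case: eqP => _; rewrite ?rmorph1 ?mulr1.
Qed.

(** [T ^ n] on every qubit gives a word of weight [m] the phase [zeta ^ (n * m)], which is 1 on C2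
    and [zeta ^ (n * n) = zeta] on the rest of C1. *)
Lemma transversal_T_of_weights n (Q : css_code n) :
    dual (dual (css_C1 Q)) = css_C1 Q ->
    (n * n = 1 %[mod 8])%N ->
    (forall x, x \in css_C1 Q ->
       if x \in css_C2 Q then (8 %| hweight x)%N else (hweight x == n %[mod 8])%N) ->
  transversal_T R Q.
Proof.
move=> dd nn wC1; pose q := zeta ^+ n.
have phaseE x : x \in css_C1 Q ->
    q ^+ hweight x = if x \in css_C2 Q then 1 else zeta.
  move=> /wC1; rewrite /q -exprM; case: ifP => _.
    case/dvdnP=> k ->; rewrite mulnA mulnC exprM T_phase8 expr1n //.
  move=> /eqP e; rewrite -[RHS]expr1; apply: T_phase_mod8.
  by rewrite -modnMmr e modnMmr.
have sub := subvP (css_sub Q).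
exists (fun=> phase_gate q), 1; split.
- move=> _; apply: phase_gate_unitary.
  by rewrite /q rmorphXn -exprMn T_phase_norm expr1n.
- exact: normr1.
- move=> psi [psiX psiZ]; split=> c Cc; apply/ffunP=> x; last first.
    rewrite ffunE tensor_phase_gate mulrCA; congr (_ * _).
    by have /ffunP/(_ x) := psiZ c Cc; rewrite ffunE.
  rewrite ffunE !tensor_phase_gate.
  have /ffunP/(_ x) := psiX c Cc; rewrite ffunE => ->.
  have [->|psi0] := eqVneq (psi x) 0; first by rewrite !mulr0.
  congr (_ * _).
  (* Code states are supported on C1: a Z-stabilizer violated at [x] gives [psi x = - psi x]. *)
  have xC : x \in css_C1 Q.
    rewrite -dd; apply/mem_dualP=> c' C'; apply/eqP; apply: contraNT psi0 => dc.
    have /ffunP/(_ x) := psiZ c' C'; rewrite ffunE.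
    have -> : dotp c' x = 1 by case: (F2P (dotp c' x)) dc => ->.
    rewrite /= expr1 mulN1r => /eqP; rewrite eq_sym -addr_eq0 -mulr2n -mulr_natl mulf_eq0.
    by rewrite pnatr_eq0.
  have xcC : x - c \in css_C1 Q by apply: memvB xC (sub _ Cc).
  by rewrite !phaseE // rpredBr.
- apply/ffunP=> x; rewrite tensor_phase_gate scale1r sum_ffunE mulr_sumr.
  apply: eq_bigr => c Cc; rewrite ffunE; case: eqP => [->|_]; last by rewrite mulr0.
  by rewrite phaseE ?sub // Cc mul1r.
- move=> u uC1 uC2; apply/ffunP=> x; rewrite tensor_phase_gate mul1r ffunE sum_ffunE.
  rewrite mulr_sumr scaler_sumr.
  apply: eq_bigr => c Cc; rewrite ffunE; case: eqP => [->|_]; last by rewrite mulr0 scaler0.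
  have cuC : c + u \in css_C1 Q by apply: memvD (sub _ Cc) uC1.
  by rewrite phaseE // rpredDl // (negPf uC2).
Qed.

End TransversalT.

(** * The family of codes *)

Lemma odd_square_mod8 n : odd n -> (n * n = 1 %[mod 8])%N.
Proof.
move=> on; rewrite -[n]odd_double_half on add1n -muln2.
(* With [m = n./2] the square is [4 m (m + 1) + 1], and one of two consecutive integers is even. *)
have /dvdnP[k Ek] : (2 %| n./2 * n./2.+1)%N by rewrite dvdn2 oddM /= andbN.
rewrite (_ : _ * _ = k * 8 + 1)%N ?modnMDl //; move: Ek; nia.
Qed.

Lemma card_colors3 : #|colors 3| = 4%N.
Proof. exact: card_colors. Qed.

Lemma tower_odd t : odd (tower_size 3 t).
Proof.
by elim: t => [|t IH]; rewrite ?tower_size0 // tower_sizeS oddD mul2n odd_double.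
Qed.

Definition tower_code (t : nat) : color_code_3d :=
  lattice_color_code card_colors3 (@tower_connected 3 t) (@tower_spherical 3 t)
    (@tower_complete 3 t).

Lemma tower_transversal_T (R : realType) t : transversal_T R (cc_code (tower_code t)).
Proof.
apply: transversal_T_of_weights.
- exact: dual_dual.
- apply: odd_square_mod8; rewrite num_qubitsE; exact: tower_odd.
- by move=> x; apply: weight_C1; [apply: tower_even | apply: tower_complete].
Qed.

Theorem mainTheorem7 (R : realType) :
  exists F : nat -> color_code_3d,
    forall k : nat, (1 <= k)%N ->
      [/\ (cc_length (F k))%:R
            = 2%:R / 3%:R * k%:R * (k%:R + 1) * (2%:R * k%:R + 1)
              - (2%:R * k%:R + 1) :> rat,
          css_parameters (cc_code (F k)) 1 (2 * k - 1)%N,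
          transversal_T R (cc_code (F k))
        & forall c, c \in css_C2 (cc_code (F k)) -> (8 %| hweight c)%N].
Proof.
(* The shift is due to the tower at [t] having distance [2 * t + 1], which is to be [2 * k - 1]. *)
exists (fun k => tower_code k.-1) => -[//|t] _ /=; split.
- rewrite /cc_length num_qubitsE -/(tower_size 3 t).
  have /(congr1 (fun n => n%:R : rat)) := tower_size_3 t.
  rewrite !(natrD, natrM) (_ : t.+1%:R = t%:R + 1); last by rewrite -natr1.
  set n := (tower_size 3 t)%:R; set x := t%:R => e.
  apply: (@mulfI _ (3%:R : rat)) => //; apply: (addIr (3%:R * (2%:R * x + 3%:R))).
  by rewrite e; field.
- rewrite (_ : 2 * t.+1 - 1 = 2 * t + 1)%N; last by lia.
  apply: lattice_code_parameters.
  + exact: tower_even.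
  + exact: (@tower_distance 3 t).
  + exact: (@tower_min_logical 2 t).
  + exact: tower_odd.
- exact: tower_transversal_T.
- by move=> c; apply: weight_lattice_code; apply: tower_even.
Qed.
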